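(* Let $R$ be a commutative ring with identity, and let $R[X_1,X_2,\dots,X_n]$ be the polynomial ring in $n$ indeterminates over $R$. Then $$\mathrm{G\text{-}gldim}(R[X_1,X_2,\dots,X_n])=\mathrm{G\text{-}gldim}(R)+n.$$
   Context: All rings are commutative with identity and all modules are unital; no Noetherian hypothesis is assumed. An $R$-module $M$ is Gorenstein projective if there is an exact sequence of projective $R$-modules $\mathbf P=\cdots\to P_1\to P_0\to P^0\to P^1\to\cdots$ with $M\cong \mathrm{Im}(P_0\to P^0)$ such that $\mathrm{Hom}_R(\mathbf P,Q)$ is exact for every projective $R$-module $Q$. The Gorenstein projective dimension $\mathrm{Gpd}_R(M)$ of a nonzero module $M$ is the least integer $k\ge 0$ such that there is an exact sequence $0\to G_k\to\cdots\to G_0\to M\to 0$ with all $G_i$ Gorenstein projective ($\infty$ if no such $k$ exists); the zero module has dimension $-\infty$ by the usual convention. Gorenstein injective modules and the Gorenstein injective dimension $\mathrm{Gid}_R(M)$ are defined dually. The Gorenstein global dimension of $R$ is $\mathrm{G\text{-}gldim}(R)=\sup\{\mathrm{Gpd}_R(M)\mid M \text{ an } R\text{-module}\}$, which may be infinite; it is known that this equals $\sup\{\mathrm{Gid}_R(M)\mid M \text{ an } R\text{-module}\}$ for every ring $R$. *)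

(* Defs.v *)
From HB Require Import structures.
From mathcomp Require Import all_boot all_order all_algebra.
From mathcomp Require Import boolp classical_sets constructive_ereal.
From mathcomp Require Import -(notations) mpoly.

Set Implicit Arguments.
Unset Strict Implicit.
Unset Printing Implicit Defensive.

Import Order.TTheory GRing.Theory Num.Theory.
Local Open Scope ring_scope.

(* Rings are [comPzRingType]s, so the zero ring is included.  The eqType and
   choiceType structures packed in [comPzRingType] and [lmodType] are no
   restriction: classically, every type carries them. *)

Definition surjective (A B : Type) (f : A -> B) : Prop :=
  forall b, exists a, f a = b.

(* exactness of A --f--> B --g--> C at B *)
Definition exact_at (A B : Type) (C : zmodType) (f : A -> B) (g : B -> C) :
    Prop :=
  forall b, g b = 0 <-> exists a, f a = b.

Section GorensteinProjective.
Variable R : comPzRingType.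

Definition projective (P : lmodType R) : Prop :=
  forall (A B : lmodType R) (p : {linear A -> B}) (f : {linear P -> B}),
    surjective p -> exists g : {linear P -> A}, forall x, p (g x) = f x.

(* Doubly infinite sequences are indexed cohomologically by int: the module
   written P_i (i >= 0) is [P (- i)], and P^i (i >= 0) is [P (i + 1)], so that
   the middle map P_0 -> P^0 is [d 0 : P 0 -> P (0 + 1)]. *)
Definition exact_sequence (P : int -> lmodType R)
    (d : forall i, {linear P i -> P (i + 1)}) : Prop :=
  forall i, exact_at (d i) (d (i + 1)).

(* exactness of Hom_R(P, Q), whose maps are h |-> h \o d i, at each
   Hom_R(P (i + 1), Q) *)
Definition Hom_exact (P : int -> lmodType R)
    (d : forall i, {linear P i -> P (i + 1)}) (Q : lmodType R) : Prop :=
  forall i (g : {linear P (i + 1) -> Q}),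
    (forall x, g (d i x) = 0) <->
    exists h : {linear P (i + 1 + 1) -> Q}, forall x, h (d (i + 1) x) = g x.

(* M is isomorphic to the submodule Im f of B *)
Definition isom_image (M A B : lmodType R) (f : {linear A -> B}) : Prop :=
  exists u : {linear M -> B},
    injective u /\ forall b, (exists m, u m = b) <-> (exists a, f a = b).

Definition gorenstein_projective (M : lmodType R) : Prop :=
  exists (P : int -> lmodType R) (d : forall i, {linear P i -> P (i + 1)}),
    [/\ forall i, projective (P i),
        exact_sequence d,
        isom_image M (d 0)
      & forall Q : lmodType R, projective Q -> Hom_exact d Q].

(* an exact sequence 0 -> G_k -> ... -> G_0 -> M -> 0 with all G_i Gorenstein
   projective, the sequence being extended by G_i = 0 for i > k *)
Definition gorenstein_resolution (M : lmodType R) (k : nat) : Prop :=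
  exists (G : nat -> lmodType R) (d : forall i, {linear G i.+1 -> G i})
         (e : {linear G 0%N -> M}),
    [/\ forall i, (i <= k)%N -> gorenstein_projective (G i),
        forall i, (k < i)%N -> forall x : G i, x = 0,
        surjective e,
        exact_at (d 0%N) e
      & forall i, exact_at (d i.+1) (d i)].

Local Open Scope classical_set_scope.
Local Open Scope ereal_scope.

Definition Gpd (M : lmodType R) : \bar int :=
  if `[< forall x : M, x = 0%R >] then -oo
  else xget +oo [set k%:Z%:E | k in
         [set k : nat | gorenstein_resolution M k /\
            forall j, gorenstein_resolution M j -> (k <= j)%N]].

Definition G_gldim : \bar int :=
  supremum -oo [set g | exists M : lmodType R, g = Gpd M].

End GorensteinProjective.

(* [mpoly] requires a ring with 1 != 0; [nontrivial h] is R with that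
   structure. *)
Definition nontrivial (R : comPzRingType) (h : 1 != 0 :> R) : Type := R.

HB.instance Definition _ (R : comPzRingType) (h : 1 != 0 :> R) :=
  GRing.ComPzRing.on (nontrivial h).
HB.instance Definition _ (R : comPzRingType) (h : 1 != 0 :> R) :=
  GRing.PzSemiRing_isNonZero.Build (nontrivial h) h.

(* R[X_1, ..., X_n].  If 1 = 0 in R, then R[X_1, ..., X_n] is the zero ring,
   that is, R itself. *)
Definition polynomial_ring (R : comPzRingType) (n : nat) : comPzRingType :=
  match pselect (1 != 0 :> R) with
  | left h => mpoly n (nontrivial h) : comPzRingType
  | right _ => R
  end.

Lemma polynomial_ringE (R : comNzRingType) (n : nat) :
  polynomial_ring R n = (mpoly n R : comPzRingType).
Proof.
rewrite /polynomial_ring; case: pselect => h; last first.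
  by exfalso; apply: h; rewrite oner_eq0.
have e : (nontrivial h : comNzRingType) = R :> comNzRingType.
  move: h; case: R => T c h; move: h.
  case: c => m0 m1 m2 m3 m4 m5 m6 m7 m8 m9 [q] mc h.
  by rewrite (Prop_irrelevance q h).
exact: (congr1 (fun S : comNzRingType => (mpoly n S : comPzRingType)) e).
Qed.

(* Main.v *)
(* The invariant that makes both inequalities short is "hull k M": M embeds in a
   module of projective dimension at most k with Gorenstein projective cokernel.
   It is equivalent to Gpd M <= k, and it passes from A and B to B/A at the cost
   of raising k by one.  Let S = R[X].

   Upper bound: an S-module M has the presentation
   0 -> M[X] -> M[X] -> M -> 0, and M |-> M[X] preserves projectivity, complete
   resolutions, hence hulls.

   Lower bound: reduction modulo X preserves complete resolutions, because an
   R-projective module has projective dimension at most 1 over S.  Given an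
   R-module M, let X act on N = M[X^-1] by the surjective shift, whose kernel is
   M, and take a hull N <= L of dimension k + 1 over S, with L/N X-torsion free.
   Then M is the X-torsion of L, that is, Tor_1(L, S/X), so if 0 -> K -> P -> L
   -> 0 is exact with P projective, M embeds in K/XK, which has projective
   dimension at most k over R, and the cokernel is Gorenstein projective. *)
Require Import Defs.
From HB Require Import structures.
From mathcomp Require Import all_boot all_order all_algebra.
From mathcomp Require Import boolp classical_sets functions constructive_ereal.
From mathcomp Require Import -(notations) mpoly.

Set Implicit Arguments.
Unset Strict Implicit.
Unset Printing Implicit Defensive.

Import GRing.Theory.
Local Open Scope ring_scope.

(** * Modules and short exact sequences *)

(** The obvious test module over S is M with X acting as zero, but then L/XL is an extension of G/XG
    by M, and the kernel of P/XP -> L/XL escapes control. The module N = M[X^-1] is chosen because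
    it is also X-divisible: N = XN gives L/XL = G/XG, so the cokernel of M -> K/XK is the kernel of
    a surjection from a projective module onto a Gorenstein projective one.

    No derived functor is constructed. Vanishing of Ext^1 is stated as extension of maps, vanishing
    of Tor_1 with S/X as absence of X-torsion, and extension of scalars by its universal property.
    The one-variable step is proved for an abstract polynomial extension, so that it applies as it
    stands to n+1 variables over n variables. *)

Lemma lmod_of_ops (R : comPzRingType) (T : Type) (zero : T) (opp : T -> T)
    (add : T -> T -> T) (scale : R -> T -> T) :
  associative add -> commutative add -> left_id zero add ->
  left_inverse zero opp add ->
  (forall a b v, scale a (scale b v) = scale (a * b) v) ->
  left_id 1 scale -> right_distributive scale add ->
  (forall v a b, scale (a + b) v = add (scale a v) (scale b v)) ->
  exists (N : lmodType R) (e : T -> N),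
    [/\ bijective e, forall x y, e (add x y) = e x + e y
      & forall a x, e (scale a x) = a *: e x].
Proof.
move=> addA addC add0 addN sA s1 sDr sDl.
(* Classical choice supplies the eqType and choiceType of [T]. The map [e] is the identity, but the
   existential statement keeps the packed structures out of later goals. *)
pose C : choiceType := HB.pack T (gen_choiceMixin T) (gen_eqMixin T).
pose zmix := @GRing.isZmodule.Build C zero opp add addA addC add0 addN.
pose Z : zmodType := HB.pack (Choice.sort C) zmix.
pose lmix := @GRing.Zmodule_isLmodule.Build R Z scale sA s1 sDr sDl.
pose N : lmodType R := HB.pack (GRing.Zmodule.sort Z) lmix.
by exists N, (fun x => x); split=> //; exists (fun x => x).
Qed.

Lemma mk_linear (R : comPzRingType) (A B : lmodType R) (f : A -> B) :
  (forall a x y, f (a *: x + y) = a *: f x + f y) ->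
  exists g : {linear A -> B}, forall x, g x = f x.
Proof.
move=> hf; pose mix := @GRing.isLinear.Build R A B *:%R f hf.
pose g : {linear A -> B} := HB.pack f mix.
by exists g.
Qed.

Lemma sval_inj (T : Type) (P : T -> Prop) : injective (@sval T P).
Proof. by case=> x Px [y Py] /= e; apply: eq_exist. Qed.

Section Modules.
Variable R : comPzRingType.
Implicit Types A B C E G K KA KC L M N P PA PC Q X : lmodType R.

Definition submodule M (U : M -> Prop) : Prop :=
  U 0 /\ forall a x y, U x -> U y -> U (a *: x + y).

Lemma submodule_exists M (U : M -> Prop) : submodule U ->
  exists N (i : {linear N -> M}),
    injective i /\ forall x, U x <-> exists n, i n = x.
Proof.
case=> U0 Ulin.
have UD x y : U x -> U y -> U (x + y).
  by move=> Ux Uy; have := Ulin 1 _ _ Ux Uy; rewrite scale1r.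
have UZ a x : U x -> U (a *: x).
  by move=> Ux; have := Ulin a _ _ Ux U0; rewrite addr0.
have UN x : U x -> U (- x) by move=> /(UZ (-1)); rewrite scaleN1r.
pose T := {x : M | U x}.
have inj (x y : T) : sval x = sval y -> x = y by exact: sval_inj.
case: (@lmod_of_ops R T (exist _ 0 U0)
  (fun x => exist _ _ (UN _ (svalP x)))
  (fun x y => exist _ _ (UD _ _ (svalP x) (svalP y)))
  (fun a x => exist _ _ (UZ a _ (svalP x)))).
- by move=> x y z; apply: inj; rewrite /= addrA.
- by move=> x y; apply: inj; rewrite /= addrC.
- by move=> x; apply: inj; rewrite /= add0r.
- by move=> x; apply: inj; rewrite /= addNr.
- by move=> a b x; apply: inj; rewrite /= scalerA.
- by move=> x; apply: inj; rewrite /= scale1r.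
- by move=> a x y; apply: inj; rewrite /= scalerDr.
- by move=> x a b; apply: inj; rewrite /= scalerDl.
move=> N [e [[e' eK e'K] eD eZ]].
have [|i iE] := @mk_linear R N M (fun n => sval (e' n)).
  by move=> a x y; rewrite -[x]e'K -[y]e'K -eZ -eD !eK.
exists N, i; split=> [x y|x].
  by rewrite !iE => /inj /(congr1 e); rewrite !e'K.
split=> [Ux|[n <-]]; last by rewrite iE; exact: svalP.
by exists (e (exist _ x Ux)); rewrite iE eK.
Qed.

Lemma quotient_exists M (U : M -> Prop) : submodule U ->
  exists N (p : {linear M -> N}), surjective p /\ forall x, p x = 0 <-> U x.
Proof.
case=> U0 Ulin.
have UD x y : U x -> U y -> U (x + y).
  by move=> Ux Uy; have := Ulin 1 _ _ Ux Uy; rewrite scale1r.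
have UZ a x : U x -> U (a *: x).
  by move=> Ux; have := Ulin a _ _ Ux U0; rewrite addr0.
have UN x : U x -> U (- x) by move=> /(UZ (-1)); rewrite scaleN1r.
(* Cosets are predicates, so extensionality turns congruence modulo [U] into equality; operations
   act on chosen representatives, and [cl] absorbs the choice. *)
pose coset (x : M) : M -> Prop := fun y => U (y - x).
have cosetE x y : coset x = coset y <-> U (x - y).
  split=> [e|Uxy].
    by have : coset x x by [rewrite /coset subrr]; rewrite e.
  apply/funext => z; apply/propext; rewrite /coset; split=> Uz.
    by rewrite -(subrK x z) -addrA; apply: UD.
  by rewrite -(subrK y z) -addrA; apply: UD => //; rewrite -opprB; apply: UN.
pose T := {c : M -> Prop | exists x, c = coset x}.
pose cl x : T := exist _ (coset x) (ex_intro _ x erefl).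
pose rep (c : T) : M := sval (cid (svalP c)).
have repE c : cl (rep c) = c.
  by apply: sval_inj; rewrite /= /rep; case: cid => x /= ->.
have clE x y : cl x = cl y <-> U (x - y).
  split=> [/(congr1 sval) /= /cosetE //|/cosetE ?]; exact: sval_inj.
have repcl x : U (rep (cl x) - x) by apply/clE; rewrite repE.
have clD x y : cl (rep (cl x) + rep (cl y)) = cl (x + y).
  by apply/clE; rewrite opprD addrACA; apply: UD.
have clZ a x : cl (a *: rep (cl x)) = cl (a *: x).
  by apply/clE; rewrite -scalerBr; apply: UZ.
have ind (V : T -> Prop) : (forall x, V (cl x)) -> forall c, V c.
  by move=> VU c; rewrite -(repE c).
case: (@lmod_of_ops R T (cl 0) (fun x => cl (- rep x))
  (fun x y => cl (rep x + rep y)) (fun a x => cl (a *: rep x))).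
- elim/ind=> x; elim/ind=> y; elim/ind=> z.
  by rewrite (clD y z) (clD x y) !clD addrA.
- by elim/ind=> x; elim/ind=> y; rewrite addrC.
- by elim/ind=> x; rewrite clD add0r.
- by elim/ind=> x; rewrite -scaleN1r clZ clD scaleN1r addNr.
- by move=> a b; elim/ind=> x; rewrite !clZ scalerA.
- by elim/ind=> x; rewrite clZ scale1r.
- by move=> a; elim/ind=> x; elim/ind=> y; rewrite clD !clZ clD scalerDr.
- by elim/ind=> x a b; rewrite !clZ clD scalerDl.
move=> N [e [[e' eK e'K] eD eZ]].
have [|p pE] := @mk_linear R M N (fun x => e (cl x)).
  by move=> a x y; rewrite -clD eD -clZ eZ.
have p0 : e (cl 0) = 0 by rewrite -pE linear0.
exists N, p; split=> [n|x].
  by exists (rep (e' n)); rewrite pE repE e'K.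
rewrite pE -p0; split=> [/(can_inj eK) /clE|]; first by rewrite subr0.
by move=> Ux; congr e; apply/clE; rewrite subr0.
Qed.

Lemma factor_surj A B C (p : {linear A -> B}) (f : {linear A -> C}) :
  surjective p -> (forall x, p x = 0 -> f x = 0) ->
  exists g : {linear B -> C}, forall x, g (p x) = f x.
Proof.
move=> /choice[s sK] pf.
have h x y : p x = p y -> f x = f y.
  by move=> e; apply/eqP; rewrite -subr_eq0 -linearB pf // linearB e subrr.
have [|g gE] := @mk_linear R B C (fun x => f (s x)).
  by move=> a x y; rewrite -linearP; apply: h; rewrite linearP !sK.
by exists g => x; rewrite gE; apply: h; rewrite sK.
Qed.

Lemma factor_inj A B C (i : {linear B -> A}) (f : {linear C -> A}) :
  injective i -> (forall c, exists b, i b = f c) ->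
  exists g : {linear C -> B}, forall c, i (g c) = f c.
Proof.
move=> iI /choice[s sK].
have [|g gE] := @mk_linear R C B s.
  by move=> a x y; apply: iI; rewrite linearP !sK linearP.
by exists g => c; rewrite gE.
Qed.

(** * Short exact sequences, pullbacks and horseshoe lemmas *)

Definition ses A B C (i : {linear A -> B}) (p : {linear B -> C}) : Prop :=
  [/\ injective i, surjective p & exact_at i p].

Definition ses_ex A B C : Prop :=
  exists (i : {linear A -> B}) (p : {linear B -> C}), ses i p.

Lemma linear_inj0 A B (i : {linear A -> B}) :
  (forall x, i x = 0 -> x = 0) -> injective i.
Proof.
move=> h x y e; apply/eqP; rewrite -subr_eq0; apply/eqP/h.
by rewrite linearB e subrr.
Qed.

Lemma ses0 A B C (i : {linear A -> B}) (p : {linear B -> C}) :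
  ses i p -> forall a, p (i a) = 0.
Proof. by case=> _ _ e a; apply/e; exists a. Qed.

Lemma inj0 A B (i : {linear A -> B}) :
  injective i -> forall x, i x = 0 -> x = 0.
Proof. by move=> iI x ix; apply: iI; rewrite linear0. Qed.

Lemma kernel_ses B C (p : {linear B -> C}) :
  surjective p -> exists K (i : {linear K -> B}), ses i p.
Proof.
move=> pS; have [|K [i [iI iE]]] := @submodule_exists B (fun x => p x = 0).
  by split=> [|a x y px py]; rewrite ?linear0 // linearP px py scaler0 addr0.
by exists K, i; split.
Qed.

Lemma cokernel_ses A B (i : {linear A -> B}) :
  injective i -> exists C (p : {linear B -> C}), ses i p.
Proof.
move=> iI.
have [|C [p [pS pE]]] := @quotient_exists B (fun x => exists a, i a = x).
  split=> [|a _ _ [x <-] [y <-]]; first by exists 0; rewrite linear0.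
  by exists (a *: x + y); rewrite linearP.
by exists C, p; split.
Qed.

Lemma image_ses A B (f : {linear A -> B}) :
  exists N (p : {linear A -> N}) (i : {linear N -> B}),
    [/\ surjective p, injective i & forall x, i (p x) = f x].
Proof.
have [|N [i [iI iE]]] := @submodule_exists B (fun y => exists x, f x = y).
  split=> [|a _ _ [x <-] [y <-]]; first by exists 0; rewrite linear0.
  by exists (a *: x + y); rewrite linearP.
have [|p pE] := factor_inj (i := i) (f := f) iI.
  by move=> x; apply/iE; exists x.
exists N, p, i; split=> // n.
have [x fx] : exists x, f x = i n by apply/iE; exists n.
by exists x; apply: iI; rewrite pE.
Qed.

(** Third isomorphism theorem: the preimage [X] of [K] in [B] is at once the kernel of [B -> N] and
    an extension of [K] by [A]. Every exchange of resolutions below rests on this double role. *)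
Lemma ses_comp A B C K N (i : {linear A -> B}) (p : {linear B -> C})
    (j : {linear K -> C}) (q : {linear C -> N}) :
  ses i p -> ses j q ->
  exists X (x : {linear X -> B}) (k : {linear A -> X}) (y : {linear X -> K}),
    [/\ exists r : {linear B -> N}, ses x r /\ forall b, r b = q (p b),
        ses k y, forall a, x (k a) = i a & forall z, j (y z) = p (x z)].
Proof.
move=> [iI pS ip] [jI qS jq].
have [r rE] : exists r : {linear B -> N}, forall b, r b = q (p b).
  by exists (q \o p).
have [|X [x xr]] := @kernel_ses B N r.
  by move=> n; have [c <-] := qS n; have [b <-] := pS c; exists b.
have [xI _ xrE] := xr.
have [|k kE] := factor_inj (i := x) (f := i) xI.
  move=> a; apply/xrE; rewrite rE.
  by have /ip -> : exists a', i a' = i a; [exists a|rewrite linear0].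
have [|y yE] := factor_inj (i := j) (f := p \o x) jI.
  by move=> z; apply/jq; rewrite /= -rE; apply/xrE; exists z.
exists X, x, k, y; split=> //; first by exists r.
split=> [a a' e|c|z].
- by apply: iI; rewrite -!kE e.
- have [b pb] := pS (j c); have [z xz] : exists z, x z = b.
    by apply/xrE; rewrite rE pb; apply/jq; exists c.
  by exists z; apply: jI; rewrite yE /= xz.
- split=> [yz|[a <-]].
    have /ip[a ia] : p (x z) = 0 by rewrite -[p _]yE yz linear0.
    by exists a; apply: xI; rewrite kE.
  apply: jI; rewrite yE /= kE linear0; apply/ip; by exists a.
Qed.

Lemma ses_pullback A B C M (i : {linear A -> B}) (p : {linear B -> C})
    (f : {linear M -> C}) :
  ses i p ->
  exists E (j : {linear A -> E}) (q : {linear E -> M}) (e : {linear E -> B}),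
    [/\ ses j q, forall a, e (j a) = i a, forall z, p (e z) = f (q z)
      & forall X (u : {linear X -> B}) (v : {linear X -> M}),
          (forall x, p (u x) = f (v x)) ->
          exists w : {linear X -> E}, forall x, e (w x) = u x /\ q (w x) = v x].
Proof.
move=> [iI pS ip].
have [|E [k [kI kE]]] :=
    @submodule_exists (M * B)%type (fun z => p z.2 = f z.1).
  split=> [|a x y /= ex ey]; first by rewrite !linear0.
  by rewrite !linearP ex ey.
have lift X (u : {linear X -> B}) (v : {linear X -> M}) :
    (forall x, p (u x) = f (v x)) ->
    exists w : {linear X -> E}, forall x, k (w x) = (v x, u x).
  move=> uv; have [|z zE] := @mk_linear R X (M * B)%type (fun x => (v x, u x)).
    by move=> a x y; rewrite !linearP.
  have [|w wE] := factor_inj (i := k) (f := z) kI; last first.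
    by exists w => x; rewrite wE zE.
  by move=> x; apply/kE; rewrite zE /=.
have [|j jE] := lift A i \0.
  move=> a; rewrite linear0; apply/ip; by exists a.
have [q qE] : exists q : {linear E -> M}, forall z, q z = (k z).1.
  by exists (fst \o k).
have [e eE] : exists e : {linear E -> B}, forall z, e z = (k z).2.
  by exists (snd \o k).
have kP z : p (k z).2 = f (k z).1 by apply/kE; exists z.
exists E, j, q, e; split.
- split=> [a a' ea|m|z].
  + by apply: iI; have := congr1 snd (jE a); rewrite ea jE.
  + have [b pb] := pS (f m); have [z zE] : exists z, k z = (m, b) by apply/kE.
    by exists z; rewrite qE zE.
  + rewrite qE; split=> [kz|[a <-]]; last by rewrite jE.
    have /ip[a ia] : p (k z).2 = 0 by rewrite kP kz linear0.
    by exists a; apply: kI; rewrite jE ia /= -kz; case: (k z).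
- by move=> a; rewrite eE jE.
- by move=> z; rewrite eE qE.
- move=> X u v uv; have [w wE] := lift X u v uv.
  by exists w => x; rewrite eE qE wE.
Qed.

Lemma linear_inl A B :
  exists l : {linear A -> (A * B)%type}, forall x, l x = (x, 0).
Proof.
apply: (mk_linear (f := fun x : A => (x, 0) : (A * B)%type)) => a x y.
by apply/eqP; rewrite xpair_eqE /= scaler0 addr0 !eqxx.
Qed.

Lemma linear_inr A B :
  exists l : {linear B -> (A * B)%type}, forall x, l x = (0, x).
Proof.
apply: (mk_linear (f := fun x : B => (0, x) : (A * B)%type)) => a x y.
by apply/eqP; rewrite xpair_eqE /= scaler0 addr0 !eqxx.
Qed.

Lemma projective_prod P Q :
  projective P -> projective Q -> projective (P * Q)%type.
Proof.
move=> hP hQ A B p f pS.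
have [u uE] := linear_inl P Q; have [v vE] := linear_inr P Q.
have [u' u'E] := hP A B p (f \o u) pS; have [v' v'E] := hQ A B p (f \o v) pS.
have [|g gE] := @mk_linear R (P * Q)%type A (fun z => u' z.1 + v' z.2).
  by move=> a x y /=; rewrite !linearP scalerDr addrACA.
exists g => -[x y]; rewrite gE linearD u'E v'E /= uE vE -linearD.
suff -> : (x, 0) + (0, y) = (x, y) :> (P * Q)%type by [].
by apply/eqP; rewrite xpair_eqE /= addr0 add0r !eqxx.
Qed.

(** Horseshoe lemma: [PC -> C] lifts to [B], so that [PA * PC] covers [B] and the kernels form a
    sequence of their own. *)
Lemma horseshoe_kernel A B C KA PA KC PC
    (i : {linear A -> B}) (p : {linear B -> C})
    (kA : {linear KA -> PA}) (qA : {linear PA -> A})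
    (kC : {linear KC -> PC}) (qC : {linear PC -> C}) :
  ses i p -> ses kA qA -> ses kC qC -> projective PC ->
  exists N, ses_ex N (PA * PC)%type B /\ ses_ex KA N KC.
Proof.
move=> [iI pS ip] [kAI qAS kqA] [kCI qCS kqC] hPC.
have [h hE] := hPC _ _ p qC pS.
have [|r rE] := @mk_linear R (PA * PC)%type B (fun z => i (qA z.1) + h z.2).
  by move=> a x y /=; rewrite !linearP scalerDr addrACA.
have pi a : p (i a) = 0 by apply/ip; exists a.
have [|N [n nr]] := @kernel_ses _ _ r.
  move=> b; have [y qy] := qCS (p b).
  have /ip[a ia] : p (b - h y) = 0 by rewrite linearB hE qy subrr.
  have [x qx] := qAS a.
  by exists (x, y); rewrite rE /= qx ia subrK.
have [nI _ nE] := nr.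
exists N; split; first by exists n, r.
have [l0 l0E] := linear_inl PA PC.
have [l lE] : exists l : {linear KA -> (PA * PC)%type},
    forall x, l x = (kA x, 0).
  by exists (l0 \o kA) => x; rewrite /= l0E.
have [|j jE] := factor_inj (i := n) (f := l) nI.
  move=> x; apply/nE; rewrite rE lE /= linear0 addr0.
  by have /kqA -> : exists a, kA a = kA x; [exists x|rewrite linear0].
have [|q qE] := factor_inj (i := kC) (f := snd \o n) kCI.
  move=> x; apply/kqC => /=; rewrite -hE.
  have /(congr1 p) : r (n x) = 0 by apply/nE; exists x.
  by rewrite rE linearD pi add0r linear0.
exists j, q; split=> [x y e|y|z].
- by apply: kAI; have := congr1 fst (lE x); rewrite -jE e jE lE.
- have /ip[a ia] : p (h (kC y)) = 0 by rewrite hE; apply/kqC; exists y.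
  have [x qx] := qAS a; have [z zE] : exists z, n z = (- x, kC y).
    by apply/nE; rewrite rE /= !linearN qx ia addNr.
  by exists z; apply: kCI; rewrite qE /= zE.
- split=> [qz|[x <-]]; last by apply: kCI; rewrite qE /= jE lE linear0.
  have nz2 : (n z).2 = 0 by rewrite -[_.2](qE z) qz linear0.
  have : r (n z) = 0 by apply/nE; exists z.
  rewrite rE nz2 linear0 addr0 => /(inj0 iI) /kqA[x kx].
  by exists x; apply: nI; rewrite jE lE kx -nz2; case: (n z).
Qed.

(** Dual horseshoe. As [PA] need not be injective, the extension [e] of [uA] to [B] has to be given;
    for Gorenstein projective [C] and projective [PA] it comes from Ext^1(C, PA) = 0. *)
Lemma horseshoe_cokernel A B C (A' C' : lmodType R) PA PC
    (i : {linear A -> B}) (p : {linear B -> C})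
    (uA : {linear A -> PA}) (vA : {linear PA -> A'})
    (uC : {linear C -> PC}) (vC : {linear PC -> C'})
    (e : {linear B -> PA}) :
  ses i p -> ses uA vA -> ses uC vC -> (forall a, e (i a) = uA a) ->
  exists N, ses_ex B (PA * PC)%type N /\ ses_ex A' N C'.
Proof.
move=> [iI pS ip] [uAI vAS uvA] [uCI vCS uvC] eE.
have [|s sE] := @mk_linear R B (PA * PC)%type (fun b => (e b, uC (p b))).
  by move=> a x y; rewrite !linearP.
have pi a : p (i a) = 0 by apply/ip; exists a.
have [|N [t st]] := @cokernel_ses _ _ s.
  apply: linear_inj0 => b; rewrite sE => -[eb /(inj0 uCI) /ip[a ia]].
  by rewrite -ia (inj0 uAI (x := a)) ?linear0 // -eE ia.
have [sI tS stE] := st.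
exists N; split; first by exists s, t.
have [l lE] := linear_inl PA PC.
have [|j jE] := factor_surj (p := vA) (f := t \o l) vAS.
  move=> x /uvA[a <-] /=; apply/stE; exists (i a).
  by rewrite sE eE pi linear0 lE.
have [|q qE] := factor_surj (p := t) (f := vC \o snd) tS.
  move=> x /stE[b <-] /=; apply/uvC; rewrite sE; by exists (p b).
exists j, q; split=> [|c|z].
- apply: linear_inj0 => a'; have [x <-] := vAS a'.
  rewrite jE => /stE[b]; rewrite sE lE => -[eb /(inj0 uCI) /ip[a ia]].
  by apply/uvA; exists a; rewrite -eE ia.
- have [y <-] := vCS c; exists (t (0, y)); by rewrite qE.
- have [[x y] <-] := tS z; rewrite qE /=; split=> [/uvC[c uc]|[a' ja]].
    have [b pb] := pS c; exists (vA (x - e b)); rewrite jE /= lE.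
    have <- : t (x, y) - t (s b) = t (x, y).
      by rewrite (_ : t (s b) = 0) ?subr0 //; apply/stE; exists b.
    rewrite -linearB; congr (t (_, _)); first by rewrite sE.
    by rewrite sE /= pb uc subrr.
  have [x' vx] := vAS a'; have := qE (x, y); rewrite -ja -vx jE qE lE /=.
  by rewrite linear0 => <-.
Qed.

End Modules.

(** * Gorenstein projective modules *)

Section Gorenstein.
Variable R : comPzRingType.
Implicit Types A B C E G K KA KC L M N P PA PC Q X : lmodType R.

(** Ext^1(M, Q) = 0 without Ext: pushing any extension of [M] out along a map to [Q] gives a split
    extension. *)
Definition ext1_zero M Q : Prop :=
  forall A B (i : {linear A -> B}) (p : {linear B -> M}), ses i p ->
  forall f : {linear A -> Q},
  exists g : {linear B -> Q}, forall a, g (i a) = f a.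

(** A single projective presentation suffices: [B] is a quotient of [A * P], so a map on [B] is
    glued from [f] on [A] and an extension to [P] of [f] composed with the induced map [K -> A]. *)
Lemma ext1_presentation K P M Q (i : {linear K -> P}) (p : {linear P -> M}) :
  ses i p -> projective P ->
  (forall f : {linear K -> Q},
     exists g : {linear P -> Q}, forall a, g (i a) = f a) ->
  ext1_zero M Q.
Proof.
move=> [iI pS ip] hP hext A B j q [jI qS jq] f.
have [h hE] := hP B M q p qS.
have [|k kE] := factor_inj (i := j) (f := h \o i) jI.
  by move=> x; apply/jq; rewrite /= hE; apply/ip; exists x.
have [g gE] := hext (f \o k).
have [|r rE] := @mk_linear R (A * P)%type B (fun z => j z.1 + h z.2).
  by move=> a x y /=; rewrite !linearP scalerDr addrACA.
have [|s sE] := @mk_linear R (A * P)%type Q (fun z => f z.1 + g z.2).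
  by move=> a x y /=; rewrite !linearP scalerDr addrACA.
have [||F FE] := factor_surj (p := r) (f := s).
- move=> b; have [x px] := pS (q b).
  have /jq[a ja] : q (b - h x) = 0 by rewrite linearB hE px subrr.
  by exists (a, x); rewrite rE /= ja subrK.
- move=> [a x]; rewrite rE sE /= => e.
  have /ip[k' ik] : p x = 0.
    rewrite -hE; have := congr1 q e; rewrite linearD linear0.
    by have -> : q (j a) = 0; [apply/jq; exists a|rewrite add0r].
  have -> : a = - k k'.
    apply: jI; apply/eqP; rewrite linearN kE /= ik -addr_eq0; exact/eqP.
  by rewrite -ik gE linearN addNr.
by exists F => a; have := FE (a, 0); rewrite rE sE /= !linear0 !addr0.
Qed.

(** The pullback of the sequence along [f] is an extension of [M] by [A], hence splits. *)
Lemma ext1_lift A B C M (i : {linear A -> B}) (p : {linear B -> C})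
    (f : {linear M -> C}) :
  ses i p -> ext1_zero M A ->
  exists h : {linear M -> B}, forall m, p (h m) = f m.
Proof.
move=> s hM; have [E [j [q [e [jq ej ep _]]]]] := ses_pullback f s.
have [r rE] := hM _ _ _ _ jq idfun; have [_ qS qE] := jq.
have [|F FE] := @mk_linear R E B (fun z => e z - i (r z)).
  by move=> a x y; rewrite !linearP scalerDr addrACA.
have [|h hE] := factor_surj (p := q) (f := F) qS.
  by move=> z /qE[a <-]; rewrite FE ej rE subrr.
exists h => m; have [z <-] := qS m.
by rewrite hE FE linearB (ses0 s) subr0 ep.
Qed.

Lemma projective_ext1 P Q : projective P -> ext1_zero P Q.
Proof.
move=> hP A B i p [iI pS ip] f.
have [s sE] := hP _ _ p idfun pS.
have [|F FE] := @mk_linear R B B (fun z => z - s (p z)).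
  by move=> a x y; rewrite !linearP scalerDr addrACA.
have [|r rE] := factor_inj (i := i) (f := F) iI.
  by move=> b; apply/ip; rewrite FE linearB sE subrr.
exists (f \o r) => a /=; congr (f _); apply: iI; rewrite rE FE.
by have -> : p (i a) = 0; [apply/ip; exists a|rewrite linear0 subr0].
Qed.

Lemma ext1_extension A B C Q (i : {linear A -> B}) (p : {linear B -> C}) :
  ses i p -> ext1_zero A Q -> ext1_zero C Q -> ext1_zero B Q.
Proof.
move=> s hA hC U V u v uv f.
have [X [x [k [y [[r [xr _]] ky xk _]]]]] := ses_comp uv s.
have [g gE] := hA _ _ _ _ ky f; have [h hE] := hC _ _ _ _ xr g.
by exists h => a; rewrite -xk hE gE.
Qed.

(** An extension of [M] pulls back along [r] to one of [N]; the map [s] sends [B] back into the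
    pullback, where the extended map can be evaluated. *)
Lemma ext1_retract M N Q (s : {linear M -> N}) (r : {linear N -> M}) :
  cancel s r -> ext1_zero N Q -> ext1_zero M Q.
Proof.
move=> sK hN A B i p ip f.
have [E [j [q [e [jq ej ep lift]]]]] := ses_pullback r ip.
have [F FE] := hN _ _ _ _ jq f.
have [|w wE] := lift _ idfun (s \o p); first by move=> b; rewrite /= sK.
exists (F \o w) => a /=; rewrite -FE; congr (F _).
have [z [qz ez]] : exists z, q z = 0 /\ z = w (i a) - j a.
  exists (w (i a) - j a); rewrite linearB (ses0 jq) subr0 (wE _).2 /= (ses0 ip).
  by rewrite linear0.
have /(let: And3 _ _ h := jq in h)[a' ja'] := qz.
have : e z = 0 by rewrite ez linearB ej (wE _).1 /= subrr.
have iI : injective i by case: ip.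
rewrite -ja' ej => /(inj0 iI) a'0.
by apply/eqP; rewrite -subr_eq0 -ez -ja' a'0 linear0.
Qed.

(* A class closed under taking syzygies and cosyzygies, whose members are
   Ext-orthogonal to projectives, consists of Gorenstein projectives: this is
   a coinductive form of the definition by complete resolutions. *)
Definition complete_class (T : lmodType R -> Prop) : Prop :=
  forall M, T M ->
  [/\ forall Q, projective Q -> ext1_zero M Q,
      exists P N, [/\ projective P, T N & ses_ex M P N]
    & exists P N, [/\ projective P, T N & ses_ex N P M]].

Definition gproj M : Prop := exists T, complete_class T /\ T M.

Lemma gproj_complete : complete_class gproj.
Proof.
move=> M [T [hT TM]].
have [e [P [N [hP TN s]]] [P' [N' [hP' TN' s']]]] := hT M TM.
by split=> //; [exists P, N|exists P', N']; split=> //; exists T.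
Qed.

Lemma gproj_gorenstein M : gproj M -> gorenstein_projective M.
Proof.
case=> T [hT TM]; pose D := {N | T N}; pose t0 : D := exist _ M TM.
have /choice[nxt nxtP] : forall t : D, exists t' : D,
    exists P, projective P /\ ses_ex (sval t) P (sval t').
  move=> [N TN]; have [_ [P [N' [hP TN' s]]] _] := hT N TN.
  by exists (exist _ N' TN'), P.
have /choice[prv prvP] : forall t : D, exists t' : D,
    exists P, projective P /\ ses_ex (sval t') P (sval t).
  move=> [N TN]; have [_ _ [P [N' [hP TN' s]]]] := hT N TN.
  by exists (exist _ N' TN'), P.
(* Dependent choice strings cosyzygies to the right and syzygies to the left of [M]. *)
pose Z (i : int) : D :=
  match i with Posz n => iter n nxt t0 | Negz n => iter n.+1 prv t0 end.
have ZP i : exists P, projective P /\ ses_ex (sval (Z i)) P (sval (Z (i + 1))).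
  case: i => [n|[|n]].
  - have -> : Posz n + 1 = Posz n.+1 by rewrite -addn1 PoszD.
    exact: nxtP.
  - exact: prvP.
  - have -> : Negz n.+1 + 1 = Negz n.
      by rewrite !NegzE -[n.+2]addn1 PoszD opprD subrK.
    exact: prvP.
(* The shift by one makes [Y (0 + 1)] reduce to [M], the image of the differential of degree 0. *)
pose Y (i : int) : lmodType R := sval (Z (i - 1)).
have YP i : exists P, projective P /\ ses_ex (Y i) P (Y (i + 1)).
  by rewrite /Y addrAC; exact: ZP.
have TY i : T (Y i) by exact: svalP.
pose P_ i := sval (cid (YP i)).
have hP i : projective (P_ i) by case: (svalP (cid (YP i))).
have sP i : ses_ex (Y i) (P_ i) (Y (i + 1)).
  by case: (svalP (cid (YP i))).
pose u_ i := sval (cid (sP i)).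
have vP i : exists p : {linear P_ i -> Y (i + 1)}, ses (u_ i) p.
  exact: svalP (cid (sP i)).
pose v_ i := sval (cid (vP i)).
have uv i : ses (u_ i) (v_ i) by exact: svalP (cid (vP i)).
exists P_, (fun i => u_ (i + 1) \o v_ i : {linear P_ i -> P_ (i + 1)}).
have ex i : exact_at (u_ i) (v_ i) by case: (uv i).
split=> //.
- have uI k : injective (u_ k) by case: (uv k).
  move=> i b /=; split=> [/(inj0 (uI _)) /ex[y <-]|[a <-]].
    have [x <-] : exists x, v_ i x = y by case: (uv i).
    by exists x.
  by rewrite (ses0 (uv _)) linear0.
- have -> : M = Y (0 + 1) by [].
  exists (u_ (0 + 1)); split; first by case: (uv (0 + 1)).
  move=> b; split=> [[m <-]|[a <-]]; last by exists (v_ 0 a).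
  have [x <-] : exists x, v_ 0 x = m by case: (uv 0).
  by exists x.
- move=> Q hQ i g; split=> [g0|[h hE] x]; last first.
    by rewrite -hE /= (ses0 (uv _)) !linear0.
  have [||g' g'E] := factor_surj (p := v_ (i + 1)) (f := g).
  + by case: (uv (i + 1)).
  + move=> y /ex[z <-]; have [x <-] : exists x, v_ i x = z by case: (uv i).
    exact: g0.
  (* Ext^1 of the next cosyzygy against [Q] vanishes, which extends [g'] to the following
     projective. *)
  have [e _ _] := hT _ (TY (i + 1 + 1 + 1)).
  have [h hE] := e Q hQ _ _ _ _ (uv (i + 1 + 1)) g'.
  by exists h => x; rewrite /= hE g'E.
Qed.

Lemma gorenstein_gproj M : gorenstein_projective M -> gproj M.
Proof.
case=> P [d [hP dex [u [uI uE]] dQ]].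
exists (fun N => exists i, isom_image N (d i)); split; last first.
  by exists 0, u.
have imd i : exists N (p : {linear P i -> N}) (v : {linear N -> P (i + 1)}),
    [/\ surjective p, injective v & forall x, v (p x) = d i x].
  exact: image_ses.
have imP i N (p : {linear P i -> N}) (v : {linear N -> P (i + 1)}) :
    surjective p -> (forall x, v (p x) = d i x) ->
    forall b, (exists m, v m = b) <-> (exists a, d i a = b).
  move=> pS vp b; split=> [[m <-]|[a <-]]; last by exists (p a).
  by have [x <-] := pS m; exists x.
(* Writing the degree as [i + 1 + 1] makes the types of neighbouring differentials agree without
   transport along equalities of integers. *)
move=> N [j]; have -> : j = j - 1 - 1 + 1 + 1 by rewrite !subrK.
move: (j - 1 - 1) => i {j} [n [nI nE]].
have [N' [p' [n' [p'S n'I n'p']]]] := imd i.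
have [N1 [p1 [n1 [p1S n1I n1p1]]]] := imd (i + 1).
have [N3 [p3 [n3 [p3S n3I n3p3]]]] := imd (i + 1 + 1 + 1).
have [|q qE] := factor_inj (i := n) (f := d (i + 1 + 1)) nI.
  by move=> c; apply/nE; exists c.
have qS : surjective q.
  move=> y; have /nE[x xE] : exists m, n m = n y by exists y.
  by exists x; apply: nI; rewrite qE.
have sq : ses n1 q.
  split=> // y; split=> [qy|[x <-]].
    have /dex[x <-] : d (i + 1 + 1) y = 0 by rewrite -qE qy linear0.
    by exists (p1 x).
  apply: nI; rewrite qE linear0; apply/dex.
  by apply/(imP _ _ p1 n1 p1S n1p1); exists x.
split.
- move=> Q hQ; apply: (ext1_presentation sq) => // f.
  have [|h hE] := (dQ Q hQ i (f \o p1)).1.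
    move=> x /=; rewrite (_ : p1 _ = 0) ?linear0 //; apply: n1I.
    by rewrite n1p1 linear0; apply/dex; exists x.
  exists h => a; have [x <-] := p1S a.
  by rewrite n1p1 hE.
- exists (P (i + 1 + 1 + 1)), N3; split=> //.
    by exists (i + 1 + 1 + 1), n3; split=> //; exact: imP n3p3.
  exists n, p3; split=> // b; split=> [pb|[a <-]].
    by apply/nE/dex; rewrite -n3p3 pb linear0.
  by apply: n3I; rewrite n3p3 linear0; apply/dex/nE; exists a.
- exists (P (i + 1 + 1)), N1; split=> //; last by exists n1, q.
  by exists (i + 1), n1; split=> //; exact: imP n1p1.
Qed.

Lemma gproj_ext1 M Q : gproj M -> projective Q -> ext1_zero M Q.
Proof. by move=> /gproj_complete[e _ _]; exact: e. Qed.

Lemma projective_gproj P : projective P -> gproj P.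
Proof.
move=> hP; exists (fun P => projective P); split=> // {}P {}hP.
have s : ses_ex P (P * P)%type P.
  have [l lE] := linear_inl P P.
  exists l, snd; split=> [x y|y|[x y]].
  - by rewrite !lE => -[].
  - by exists (0, y).
  - by split=> [/= ->|[a]]; [exists x; rewrite lE|rewrite lE => -[_ <-]].
split=> [Q _||]; first exact: projective_ext1.
all: by exists (P * P)%type, P; split=> //; apply: projective_prod.
Qed.

(** Extensions of Gorenstein projectives form a complete class: both horseshoes apply, the cosyzygy
    side through Ext^1(C, PA) = 0. *)
Lemma gproj_extension A B C : ses_ex A B C -> gproj A -> gproj C -> gproj B.
Proof.
move=> hs hA hC.
exists (fun N => exists A C, [/\ ses_ex A N C, gproj A & gproj C]).
split; last first.
  by exists A, C.
move=> {hs hA hC A B C} B [A [C [[i [p s]] hA hC]]].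
have [eA [PA [A1 [hPA hA1 [uA [vA sA]]]]]
  [PA' [A' [hPA' hA' [kA [qA sA']]]]]] :=
  gproj_complete hA.
have [eC [PC [C1 [hPC hC1 [uC [vC sC]]]]]
  [PC' [C' [hPC' hC' [kC [qC sC']]]]]] :=
  gproj_complete hC.
split.
- by move=> Q hQ; apply: (ext1_extension s); [exact: eA|exact: eC].
- have [e eE] := eC PA hPA _ _ _ _ s uA.
  have [N [s1 s2]] := horseshoe_cokernel s sA sC eE.
  exists (PA * PC)%type, N; split=> //; first exact: projective_prod.
  by exists A1, C1.
- have [N [s1 s2]] := horseshoe_kernel s sA' sC' hPC'.
  exists (PA' * PC')%type, N; split=> //; first exact: projective_prod.
  by exists A', C'.
Qed.

End Gorenstein.

(** * Gorenstein projective dimension *)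

Section GorensteinDimension.
Variable R : comPzRingType.
Implicit Types A B C E G K KA KC L M N P PA PC Q X Z : lmodType R.

Lemma ses_prod A B : ses_ex A (A * B)%type B.
Proof.
have [l lE] := linear_inl A B.
exists l, snd; split=> [x y|y|[x y]].
- by rewrite !lE => -[].
- by exists (0, y).
- by split=> [/= ->|[a]]; [exists x; rewrite lE|rewrite lE => -[_ <-]].
Qed.

(** Schanuel's lemma compares the kernel with a Gorenstein projective syzygy [K0] of [G] covered by
    [P0]: it is a direct summand of [K0 * P] with complement [P0]. This gives the Ext vanishing and
    a syzygy; the cosyzygy is [G] itself. *)
Lemma gproj_kernel K P G :
  ses_ex K P G -> projective P -> gproj G -> gproj K.
Proof.
move=> hs hP hG.
pose T N := exists P G, [/\ projective P, gproj G & ses_ex N P G].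
have gT N : gproj N -> T N.
  by case/gproj_complete=> _ [P' [G' [? ? ?]]] _; exists P', G'.
exists T; split; last by exists P, G.
move=> {hs hP hG K P G} N [P [G [hP hG [k [p [kI pS kp]]]]]].
have [_ _ [P0 [K0 [hP0 hK0 [k0 [p0 [k0I p0S kp0]]]]]]] := gproj_complete hG.
have [_ _ [P1 [K1 [hP1 hK1 [k1 [p1 [k1I p1S kp1]]]]]]] := gproj_complete hK0.
have [h hE] := hP _ _ p0 p p0S; have [h0 h0E] := hP0 _ _ p p0 pS.
have pk x : p (k x) = 0 by apply/kp; exists x.
have pk0 x : p0 (k0 x) = 0 by apply/kp0; exists x.
(* The values of [F] lie in the kernel of [p], since [h] and [h0] lift [p] and [p0] through each
   other. The maps [s] and [t] below are a section and the kernel of the resulting [f]. *)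
have [|F FE] :=
    @mk_linear R (K0 * P)%type P (fun z => z.2 - h0 (h z.2 + k0 z.1)).
  move=> a x y /=; rewrite !linearP addrACA -scalerDr !linearP addrACA.
  by rewrite -scalerDr.
have [|f fE] := factor_inj (i := k) (f := F) kI.
  move=> z; apply/kp; rewrite FE linearB h0E linearD hE pk0 addr0.
  exact: subrr.
have [|s0 s0E] := factor_inj (i := k0) (f := \- (h \o k)) k0I.
  by move=> n; apply/kp0; rewrite /= linearN hE pk oppr0.
have [|s sE] := @mk_linear R N (K0 * P)%type (fun n => (s0 n, k n)).
  by move=> a x y; rewrite !linearP.
have sK : cancel s f.
  move=> n; apply: kI; rewrite fE FE sE /= s0E /= subrr linear0.
  exact: subr0.
have [|t0 t0E] := factor_inj (i := k0) (f := idfun \- (h \o h0)) k0I.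
  by move=> n; apply/kp0; rewrite /= linearB hE h0E subrr.
have [|t tE] := @mk_linear R P0 (K0 * P)%type (fun n => (t0 n, h0 n)).
  by move=> a x y; rewrite !linearP.
have tf : ses t f.
  split=> [|n|z]; last split=> [fz|[y <-]].
  - apply: linear_inj0 => y; rewrite tE => -[ty hy].
    have := t0E y; rewrite ty linear0 /= hy linear0.
    by move=> e; rewrite -[y]subr0 -e.
  - by exists (s n); rewrite sK.
  - have := fE z; rewrite fz linear0 FE => /esym/eqP.
    rewrite subr_eq0 => /eqP e.
    exists (h z.2 + k0 z.1); rewrite tE; case: z e {fz} => x y /= e.
    rewrite -e; congr pair; apply: k0I.
    by rewrite t0E /= -e addrAC subrr add0r.
  - apply: kI; rewrite fE FE tE /= t0E /= linear0.
    by rewrite [h _ + _]addrC subrK subrr.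
have [i1 [q1 iq1]] : ses_ex K1 (P1 * P)%type (K0 * P)%type.
  have [l lE] := linear_inl P1 P.
  have [|q qE] :=
    @mk_linear R (P1 * P)%type (K0 * P)%type (fun z => (p1 z.1, z.2)).
    by move=> a x y; rewrite /= !linearP.
  exists (l \o k1), q; split=> [x y|[x y]|[x y]].
  - by rewrite /= !lE => -[/k1I].
  - by have [z <-] := p1S x; exists (z, y); rewrite qE.
  - rewrite qE /=; split=> [[/kp1[z <-] ->]|[z]].
      by exists z; rewrite /= lE.
    rewrite /= lE => -[<- <-]; congr pair; apply/kp1; by exists z.
(* The kernel of [P1 * P -> N] is an extension of [P0] by [K1], hence Gorenstein projective. *)
have [X [x [y [y' [[r [xr _]] yy _ _]]]]] := ses_comp iq1 tf.
split.
- move=> Q hQ; apply: (ext1_retract sK).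
  have [i [q iq]] := ses_prod K0 P.
  by apply: (ext1_extension iq); [exact: gproj_ext1|exact: projective_ext1].
- by exists P, G; split=> //; [exact: gT|exists k, p].
- exists (P1 * P)%type, X; split; [exact: projective_prod| |by exists x, r].
  apply: gT; apply: gproj_extension hK1 (projective_gproj hP0).
  by exists y, y'.
Qed.

Lemma zero_module_exists M : exists Z : lmodType R, forall x : Z, x = 0.
Proof.
have [|Z [i [iI iE]]] := @submodule_exists R M (fun x => x = 0).
  by split=> // a _ _ -> ->; rewrite scaler0 addr0.
by exists Z => x; apply: (inj0 iI); apply/iE; exists x.
Qed.

Lemma zero_module_projective Z : (forall x : Z, x = 0) -> projective Z.
Proof.
by move=> Z0 A B p f _; exists \0 => x; rewrite (Z0 x) !linear0.
Qed.

Lemma ses_idl Z M : (forall x : Z, x = 0) -> ses_ex Z M M.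
Proof.
move=> Z0; exists \0, idfun; split=> [x y _|y|y].
- by rewrite (Z0 x) (Z0 y).
- by exists y.
- by split=> [/= ->|[a <-]]; first by exists 0.
Qed.

Lemma gproj_iso M N (f : {linear M -> N}) :
  injective f -> surjective f -> gproj M -> gproj N.
Proof.
move=> fI fS hM; have [Z Z0] := zero_module_exists M.
apply: gproj_extension hM (projective_gproj (zero_module_projective Z0)).
exists f, \0; split=> [//|z|b]; first by exists 0; rewrite (Z0 z).
by split=> // _; have [a <-] := fS b; exists a.
Qed.

(** * Projective dimension and hulls *)

Fixpoint pd_le (k : nat) M : Prop :=
  if k is k'.+1 then
    exists K P, [/\ projective P, pd_le k' K & ses_ex K P M]
  else projective M.

Lemma projective_extension A B C :
  ses_ex A B C -> projective A -> projective C -> projective B.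
Proof.
move=> [i [p [iI pS ip]]] hA hC X Y q f qS.
have [s sE] := hC _ _ p idfun pS.
have [|r rE] := factor_inj (i := i) (f := idfun \- (s \o p)) iI.
  by move=> b; apply/ip; rewrite /= linearB sE subrr.
have [u uE] := hA _ _ q (f \o i) qS; have [v vE] := hC _ _ q (f \o s) qS.
have [|g gE] := @mk_linear R B X (fun b => u (r b) + v (p b)).
  by move=> a x y; rewrite !linearP addrACA scalerDr.
exists g => b; rewrite gE linearD uE vE /= rE /= -linearD; congr (f _).
exact: subrK.
Qed.

Lemma pd_le_extension k A B C :
  ses_ex A B C -> pd_le k A -> pd_le k C -> pd_le k B.
Proof.
elim: k A B C => [|k IH] A B C; first exact: projective_extension.
move=> [i [p ip]] [KA [PA [hPA hKA [kA [qA sA]]]]].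
move=> [KC [PC [hPC hKC [kC [qC sC]]]]].
have [N [s1 s2]] := horseshoe_kernel ip sA sC hPC.
exists N, (PA * PC)%type; split=> //; first exact: projective_prod.
exact: IH s2 hKA hKC.
Qed.

Lemma pd_leS k M : pd_le k M -> pd_le k.+1 M.
Proof.
elim: k M => [|k IH] M.
  have [Z Z0] := zero_module_exists M.
  exists Z, M; split=> //; [exact: zero_module_projective|exact: ses_idl].
by move=> [K [P [hP hK s]]]; exists K, P; split=> //; exact: IH.
Qed.

Lemma projective_pd_le k P : projective P -> pd_le k P.
Proof. by elim: k => // k IH /IH; exact: pd_leS. Qed.

(** The kernel of the composite [P -> B -> M] is an extension of [A] by [K], both of dimension at
    most [k]. *)
Lemma pd_le_cokernel k A B M :
  ses_ex A B M -> pd_le k A -> pd_le k.+1 B -> pd_le k.+1 M.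
Proof.
move=> [i [p ip]] hA [K [P [hP hK [j [q jq]]]]].
have [X [x [y [y' [[r [xr _]] yy _ _]]]]] := ses_comp jq ip.
exists X, P; split=> //; last by exists x, r.
by apply: pd_le_extension hK hA; exists y, y'.
Qed.

(** Dimension shifting: a map from a syzygy of [G] to [L] lifts to the projective [P] by induction,
    extends there because [P] is projective, and is pushed down again. *)
Lemma gproj_ext1_pd_le k G L : gproj G -> pd_le k L -> ext1_zero G L.
Proof.
elim: k G L => [|k IH] G L hG; first exact: gproj_ext1.
move=> [K [P [hP hK [i [p ip]]]]].
have [_ _ [P' [G' [hP' hG' [j [q jq]]]]]] := gproj_complete hG.
apply: (ext1_presentation jq) => // f.
have [h hE] := ext1_lift f ip (IH _ _ hG' hK).
have [g gE] := gproj_ext1 hG hP jq h.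
by exists (p \o g) => a; rewrite /= gE hE.
Qed.

Definition hull (k : nat) M : Prop :=
  exists L G, [/\ pd_le k L, gproj G & ses_ex M L G].

Lemma gproj_hull k G : gproj G -> hull k G.
Proof.
move=> /gproj_complete[_ [P [G' [hP hG' s]]] _].
by exists P, G'; split=> //; exact: projective_pd_le.
Qed.

Lemma hullS k M : hull k M -> hull k.+1 M.
Proof. by case=> L [G [hL hG s]]; exists L, G; split=> //; exact: pd_leS. Qed.

(** A mapping cone: since Ext^1(C, LB) = 0, the map [A -> B] extends to [LA -> LB], and adding a
    projective [P] containing [C] makes it injective. The new hull is the cokernel of
    [LA -> LB * P]; its quotient by [M] is an extension of P/C by [D]. *)
Lemma hull_cokernel k A B M :
  ses_ex A B M -> hull k A -> hull k.+1 B -> hull k.+1 M.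
Proof.
move=> [i [p [iI pS ip]]] [LA [C [hLA hC [a [c [aI cS ac]]]]]].
move=> [LB [D [hLB hD [b [d [bI dS bd]]]]]].
have [_ [P [C' [hP hC' [u [v [uI vS uv]]]]]] _] := gproj_complete hC.
have [phi phiE] : exists phi : {linear LA -> LB}, forall x, phi (a x) = b (i x).
  have sac : ses a c by [].
  by have [g gE] := gproj_ext1_pd_le hC hLB sac (b \o i); exists g.
have [|w wE] := @mk_linear R LA (LB * P)%type (fun x => (phi x, u (c x))).
  by move=> r x y; rewrite !linearP.
have [|LM [t wt]] := @cokernel_ses _ _ _ w.
  apply: linear_inj0 => x; rewrite wE => -[phix /(inj0 uI) /ac[y ay]].
  have : b (i y) = 0 by rewrite -phiE ay.
  by move=> /(inj0 bI) /(inj0 iI) y0; rewrite -ay y0 linear0.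
have hLM : pd_le k.+1 LM.
  apply: (@pd_le_cokernel k LA (LB * P)%type); [by exists w, t|exact: hLA|].
  exact: pd_le_extension (ses_prod _ _) hLB (projective_pd_le _ hP).
have [wI tS wtE] := wt.
have [l lE] := linear_inl LB P.
have [|f fE] := factor_surj (p := p) (f := t \o (l \o b)) pS.
  move=> _ /ip[x <-] /=; apply/wtE; exists (a x).
  rewrite wE phiE lE; congr pair.
  by rewrite (_ : c _ = 0) ?linear0 //; apply/ac; exists x.
have fI : injective f.
  apply: linear_inj0 => m; have [y <-] := pS m; rewrite fE /= lE.
  move=> /wtE[x]; rewrite wE => -[phix /(inj0 uI) /ac[z az]].
  by apply/ip; exists z; apply: bI; rewrite -phiE az.
have [E [g fg]] := cokernel_ses fI; have [_ gS fgE] := fg.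
exists LM, E; split=> //; last by exists f, g.
have gt0 x : g (t (x, 0)) = 0 <-> exists y, b y = x.
  split=> [/fgE[m fm]|[y <-]].
    have [y py] := pS m; move: fm; rewrite -py fE /= lE => /eqP.
    rewrite -subr_eq0 -linearB => /eqP /wtE[z]; rewrite wE => -[phiz].
    rewrite subrr => /(inj0 uI) /ac[x' ax'].
    exists (y - i x'); rewrite linearB -phiE ax' phiz.
    by rewrite opprB addrC subrK.
  by apply/fgE; exists (p y); rewrite fE /= lE.
apply: (@gproj_extension _ D E C') => //.
have [|j jE] := factor_surj (p := d) (f := g \o (t \o l)) dS.
  by move=> x /bd[y <-] /=; rewrite lE; apply/gt0; exists y.
have [|q' q'E] := factor_surj (p := t) (f := v \o snd) tS.
  by move=> z /wtE[x <-]; rewrite wE /=; apply/uv; exists (c x).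
have [|q qE] := factor_surj (p := g) (f := q') gS.
  by move=> z /fgE[m <-]; have [y <-] := pS m; rewrite fE q'E /= lE linear0.
exists j, q; split=> [|z|z].
- apply: linear_inj0 => x; have [y <-] := dS x.
  by rewrite jE /= lE => /gt0 ?; apply/bd.
- by have [y <-] := vS z; exists (g (t (0, y))); rewrite qE q'E.
- have [z1 <-] := gS z; have [[x y] <-] := tS z1.
  rewrite qE q'E /=; split=> [/uv[e ue]|[x' jx]].
    have [y' cy] := cS e; exists (d (x - phi y')).
    rewrite jE /= lE; congr (g _); apply/eqP; rewrite -subr_eq0 -linearB.
    apply/eqP/wtE; exists (- y'); rewrite wE !linearN cy ue; congr pair.
      by rewrite /= addrAC subrr add0r.
    by rewrite /= sub0r.
  have [x1 dx] := dS x'; have := congr1 q jx.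
  by rewrite -dx jE /= !qE !q'E /= lE linear0 => <-.
Qed.

(** * Hulls versus Gorenstein projective resolutions *)

Fixpoint gp_resolution (k : nat) M : Prop :=
  if k is k'.+1 then
    exists K G, [/\ gproj G, gp_resolution k' K & ses_ex K G M]
  else gproj M.

Lemma gp_resolution_hull k M : gp_resolution k M -> hull k M.
Proof.
elim: k M => [|k IH] M; first exact: gproj_hull.
by move=> [K [G [hG /IH hK s]]]; apply: (hull_cokernel s hK); exact: gproj_hull.
Qed.

Lemma pd_le_gp_resolution k L : pd_le k L -> gp_resolution k L.
Proof.
elim: k L => [|k IH] L; first exact: projective_gproj.
move=> [K [P [hP /IH hK s]]]; exists K, P; split=> //.
exact: projective_gproj.
Qed.

(** For k > 0, the preimage [X] of [M] in a projective cover map [P -> L] is the kernel of [P -> G],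
    hence Gorenstein projective, and it maps onto [M] with kernel [K]. *)
Lemma hull_gp_resolution k M : hull k M -> gp_resolution k M.
Proof.
case: k => [|k] [L [G [hL hG s]]]; first exact: gproj_kernel s hL hG.
have [K [P [hP /pd_le_gp_resolution hK [i [p ip]]]]] := hL.
have [j [q jq]] := s.
have [X [x [y [y' [[r [xr _]] yy _ _]]]]] := ses_comp ip jq.
exists K, X; split=> //; last by exists y, y'.
by apply: gproj_kernel hP hG; exists x, r.
Qed.

Lemma gorenstein_resolutionP k M :
  gorenstein_resolution M k <-> gp_resolution k M.
Proof.
split.
  elim: k M => [|k IH] M [G [d [e [hG G0 eS ex exd]]]].
    apply: (gproj_iso _ eS (gorenstein_gproj (hG 0%N isT))).
    apply: linear_inj0 => x /ex[y <-].
    by rewrite (G0 1%N isT y) linear0.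
  have [K [i ie]] := kernel_ses eS; have [iI _ ieE] := ie.
  have [|f fE] := factor_inj (i := i) (f := d 0%N) iI.
    by move=> c; apply/ieE/ex; exists c.
  exists K, (G 0%N); split; [exact/gorenstein_gproj/hG| |by exists i, e].
  apply: IH; exists (fun n => G n.+1), (fun n => d n.+1), f; split=> //.
  - by move=> n hn; apply: hG.
  - by move=> n hn; apply: G0.
  - move=> x; have [y dy] : exists y, d 0%N y = i x by apply/ex/ieE; exists x.
    by exists y; apply: iI; rewrite fE dy.
  - move=> b; split=> [fb|/exd db]; first by apply/exd; rewrite -fE fb linear0.
    by apply: iI; rewrite fE db linear0.
elim: k M => [|k IH] M.
  move=> hM; have [Z Z0] := zero_module_exists M.
  exists (fun n => if n is 0%N then M else Z).
  exists (fun n => \0), idfun; split=> //.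
  - by case=> // _; exact: gproj_gorenstein.
  - by case.
  - by move=> x; exists x.
  - by move=> x; split=> [/= ->|[? <-]]; first by exists 0.
  - move=> [|n] x; rewrite (Z0 x); split=> // _; by exists 0.
move=> [K [G0 [hG0 /IH[G [d [e [hG G_0 eS ex exd]]]] [i [p [iI pS ip]]]]]].
pose G' n : lmodType R := if n is n'.+1 then G n' else G0.
pose d' n : {linear G' n.+1 -> G' n} :=
  match n return {linear G' n.+1 -> G' n} with
  | 0%N => i \o e
  | n'.+1 => d n'
  end.
exists G', d', p; split=> //.
- by case=> [|n] hn; [exact: gproj_gorenstein|exact: hG].
- by case=> [|n] // hn; exact: G_0.
- move=> x; split=> [/ip[y <-]|[y <-]]; last by apply/ip; exists (e y).
  by have [z <-] := eS y; exists z.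
- case=> [|n]; last exact: exd.
  by move=> x /=; split=> [/(inj0 iI) /ex //|/ex ->]; exact: linear0.
Qed.

End GorensteinDimension.

(** * Base change *)

Section Semilinear.
Variables (R S : comPzRingType) (phi : {rmorphism R -> S}).

Definition semilin (M : lmodType R) (N : lmodType S) (f : M -> N) : Prop :=
  forall a x y, f (a *: x + y) = phi a *: f x + f y.

Section Map.
Variables (M : lmodType R) (N : lmodType S) (f : M -> N).
Hypothesis hf : semilin f.

Lemma semilinD x y : f (x + y) = f x + f y.
Proof. by rewrite -[x]scale1r hf rmorph1 !scale1r. Qed.

Lemma semilin0 : f 0 = 0.
Proof. by apply: (addIr (f 0)); rewrite -semilinD !add0r. Qed.

Lemma semilinZ a x : f (a *: x) = phi a *: f x.
Proof. by rewrite -[a *: x]addr0 hf semilin0 addr0. Qed.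

Lemma semilinB x y : f (x - y) = f x - f y.
Proof. by rewrite semilinD -scaleN1r semilinZ rmorphN1 scaleN1r. Qed.

Lemma semilin_inv (g : N -> M) :
  cancel f g -> cancel g f ->
  forall a x y, g (phi a *: x + y) = a *: g x + g y.
Proof.
by move=> fK gK a x y; rewrite -[x]gK -[y]gK -hf !fK.
Qed.

End Map.

Lemma semilin_compl (M : lmodType R) (N Q : lmodType S)
    (f : M -> N) (g : {linear N -> Q}) :
  semilin f -> semilin (g \o f).
Proof. by move=> hf a x y; rewrite /= hf linearP. Qed.

Lemma semilin_compr (K M : lmodType R) (N : lmodType S)
    (f : {linear K -> M}) (g : M -> N) :
  semilin g -> semilin (g \o f).
Proof. by move=> hg a x y; rewrite /= linearP hg. Qed.

Lemma restriction_exists (N : lmodType S) :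
  exists (M : lmodType R) (e : M -> N), bijective e /\ semilin e.
Proof.
case: (@lmod_of_ops R N 0 -%R +%R (fun a x => phi a *: x)).
- exact: addrA.
- exact: addrC.
- exact: add0r.
- exact: addNr.
- by move=> a b x; rewrite scalerA rmorphM.
- by move=> x; rewrite rmorph1 scale1r.
- by move=> a x y; rewrite scalerDr.
- by move=> x a b; rewrite rmorphD scalerDl.
move=> M [e [[e' eK e'K] eD eZ]].
exists M, e'; split; first by exists e.
by move=> a x y; rewrite -[x]e'K -[y]e'K -eZ -eD !eK.
Qed.

Lemma semilin_factor_surj (A B : lmodType R) (N : lmodType S)
    (p : {linear A -> B}) (f : A -> N) :
  surjective p -> semilin f -> (forall x, p x = 0 -> f x = 0) ->
  exists2 g : B -> N, semilin g & forall x, g (p x) = f x.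
Proof.
move=> /choice[s sK] hf pf.
have h x y : p x = p y -> f x = f y.
  move=> e; apply/eqP; rewrite -subr_eq0 -(semilinB hf); apply/eqP/pf.
  by rewrite linearB e subrr.
exists (f \o s) => [a x y|x] /=; last by apply: h; rewrite sK.
by rewrite -hf; apply: h; rewrite linearP !sK.
Qed.

(** The universal property of x |-> 1 ⊗ x from [M] to the extension of scalars S ⊗ M. *)
Definition base_change (M : lmodType R) (N : lmodType S) (m : M -> N) : Prop :=
  [/\ semilin m,
      forall (Q : lmodType S) (h : M -> Q), semilin h ->
        exists g : {linear N -> Q}, forall x, g (m x) = h x
    & forall (Q : lmodType S) (g g' : {linear N -> Q}),
        (forall x, g (m x) = g' (m x)) -> forall y, g y = g' y].

Lemma base_change_map (A B : lmodType R) (A' B' : lmodType S)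
    (mA : A -> A') (mB : B -> B') (f : {linear A -> B}) :
  base_change mA -> semilin mB ->
  exists g : {linear A' -> B'}, forall x, g (mA x) = mB (f x).
Proof. by move=> [_ univ _] hB; apply: univ; exact: semilin_compr. Qed.

Lemma base_change_surj (A B : lmodType R) (A' B' : lmodType S)
    (mA : A -> A') (mB : B -> B')
    (f : {linear A -> B}) (g : {linear A' -> B'}) :
  base_change mB -> surjective f -> (forall x, g (mA x) = mB (f x)) ->
  surjective g.
Proof.
move=> [_ _ uniq] fS gE.
have [|W [t [_ tE]]] := @quotient_exists S B' (fun y => exists x, g x = y).
  split=> [|a _ _ [x <-] [y <-]]; first by exists 0; rewrite linear0.
  by exists (a *: x + y); rewrite linearP.
move=> y; apply/tE; apply: (uniq W t \0) => x /=.
by apply/tE; have [z <-] := fS x; exists (mA z).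
Qed.

(** Extension of scalars is left adjoint to restriction, which preserves surjections. *)
Lemma base_change_projective (P : lmodType R) (P' : lmodType S) (m : P -> P') :
  base_change m -> projective P -> projective P'.
Proof.
move=> [hm univ uniq] hP A B p f pS.
have [A0 [a [[a' aK a'K] ha]]] := restriction_exists A.
have [B0 [b [[b' bK b'K] hb]]] := restriction_exists B.
have [|p0 p0E] := @mk_linear R A0 B0 (fun x => b' (p (a x))).
  by move=> r x y; rewrite ha linearP (semilin_inv hb bK b'K).
have [|f0 f0E] := @mk_linear R P B0 (fun x => b' (f (m x))).
  by move=> r x y; rewrite hm linearP (semilin_inv hb bK b'K).
have [|g0 g0E] := hP A0 B0 p0 f0.
  by move=> x; have [y py] := pS (b x); exists (a' y); rewrite p0E a'K py bK.
have [|g gE] := univ A (a \o g0); first exact: semilin_compr.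
exists g; apply: (uniq B (p \o g) f) => x /=; rewrite gE /=.
by apply: (can_inj b'K); rewrite -p0E g0E f0E.
Qed.

(* Base change along phi preserves complete resolutions as soon as it keeps
   the relevant sequences exact, and restriction along phi sends projectives
   to modules of finite projective dimension. *)
Variable F : forall (M : lmodType R) (N : lmodType S), (M -> N) -> Prop.
Variable D : lmodType R -> Prop.
Hypothesis F_base_change :
  forall (M : lmodType R) (N : lmodType S) (m : M -> N), F m -> base_change m.
Hypothesis F_exists : forall M : lmodType R,
  exists (N : lmodType S) (m : M -> N), F m.
Hypothesis F_inj : forall (A B C : lmodType R) (A' B' : lmodType S)
  (i : {linear A -> B}) (p : {linear B -> C})
  (mA : A -> A') (mB : B -> B') (i' : {linear A' -> B'}),
  ses i p -> D C -> F mA -> F mB -> (forall x, i' (mA x) = mB (i x)) ->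
  injective i'.
Hypothesis D_sub : forall (A B : lmodType R) (i : {linear A -> B}),
  injective i -> D B -> D A.
Hypothesis D_projective : forall P, projective P -> D P.
Hypothesis restriction_pd :
  forall (Q : lmodType S) (N : lmodType R) (e : N -> Q),
  bijective e -> semilin e -> projective Q -> exists k, pd_le k N.

Lemma base_change_ses (A B C : lmodType R) (A' B' C' : lmodType S)
    (i : {linear A -> B}) (p : {linear B -> C})
    (mA : A -> A') (mB : B -> B') (mC : C -> C') :
  ses i p -> D C -> F mA -> F mB -> F mC ->
  exists (i' : {linear A' -> B'}) (p' : {linear B' -> C'}),
    [/\ ses i' p', forall x, i' (mA x) = mB (i x)
      & forall x, p' (mB x) = mC (p x)].
Proof.
move=> s DC FA FB FC; have [iI pS ip] := s.
have [hA univA uniqA] := F_base_change FA.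
have [hB univB uniqB] := F_base_change FB.
have [hC univC uniqC] := F_base_change FC.
have [i' i'E] := base_change_map i (F_base_change FA) hB.
have [p' p'E] := base_change_map p (F_base_change FB) hC.
have i'I := F_inj s DC FA FB i'E.
exists i', p'; split=> //; split=> //.
  exact: base_change_surj (F_base_change FC) pS p'E.
have pi' : forall x, p' (i' x) = 0.
  apply: (uniqA _ (p' \o i') \0) => x /=.
  by rewrite i'E p'E (ses0 s) (semilin0 hC).
move=> y; split=> [py|[x <-]]; last exact: pi'.
(* Right exactness: the cokernel map [t] of [i'] factors through [p'], so the kernel of [p'] lies in
   the image of [i']. *)
have [W [t [_ _ it]]] := cokernel_ses i'I.
have [||h hh hE] := semilin_factor_surj (f := t \o mB) pS.
- exact: semilin_compl.
- by move=> x /ip[a <-] /=; rewrite -i'E; apply/it; exists (mA a).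
have [g gE] := univC W h hh.
have gt : forall y, g (p' y) = t y.
  by apply: (uniqB _ (g \o p') t) => x /=; rewrite p'E gE hE.
by apply/it; rewrite -gt py linear0.
Qed.

Lemma gproj_D (G : lmodType R) : gproj G -> D G.
Proof.
case/gproj_complete=> _ [P [G' [hP _ [i [p [iI _ _]]]]]] _.
exact: D_sub iI (D_projective hP).
Qed.

(** Ext vanishing against a projective [W] over [S] passes by adjunction to the restriction of [W],
    where finite projective dimension over [R] is enough. *)
Lemma base_change_gproj (G : lmodType R) (G' : lmodType S) (m : G -> G') :
  F m -> gproj G -> gproj G'.
Proof.
move=> Fm hG.
exists (fun N : lmodType S =>
  exists (G : lmodType R) (m : G -> N), F m /\ gproj G); split; last first.
  by exists G, m.
move=> {hG Fm m G G'} G' [G [m [Fm hG]]].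
have [_ [P [C [hP hC [i [p ip]]]]] [Q [K [hQ hK [j [q jq]]]]]] :=
  gproj_complete hG.
have [P' [mP FP]] := F_exists P; have [C' [mC FC]] := F_exists C.
have [Q' [mQ FQ]] := F_exists Q; have [K' [mK FK]] := F_exists K.
have [i' [p' [ip' _ _]]] := base_change_ses ip (gproj_D hC) Fm FP FC.
have [j' [q' [jq' j'E _]]] := base_change_ses jq (gproj_D hG) FK FQ Fm.
have hQ' := base_change_projective (F_base_change FQ) hQ.
have hP' := base_change_projective (F_base_change FP) hP.
split; last 2 first.
- by exists P', C'; split=> //; [exists C, mC|exists i', p'].
- by exists Q', K'; split=> //; [exists K, mK|exists j', q'].
move=> W hW; apply: (ext1_presentation jq') => // f.
have [W0 [w [[w' wK w'K] hw]]] := restriction_exists W.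
have [|k hk] := restriction_pd _ hw hW; first by exists w'.
have [hmK univK uniqK] := F_base_change FK.
have [hmQ univQ uniqQ] := F_base_change FQ.
have [|f0 f0E] := @mk_linear R K W0 (fun x => w' (f (mK x))).
  by move=> r x y; rewrite hmK linearP (semilin_inv hw wK w'K).
have [g0 g0E] := gproj_ext1_pd_le hG hk jq f0.
have [|g gE] := univQ W (w \o g0); first exact: semilin_compr.
exists g; apply: (uniqK _ (g \o j') f) => x /=.
by rewrite j'E gE /= g0E f0E w'K.
Qed.

Lemma base_change_pd_le k (M : lmodType R) (M' : lmodType S) (m : M -> M') :
  F m -> D M -> pd_le k M -> pd_le k M'.
Proof.
elim: k M M' m => [|k IH] M M' m Fm DM.
  exact: base_change_projective (F_base_change Fm).
move=> [K [P [hP hK [i [p ip]]]]].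
have [P' [mP FP]] := F_exists P; have [K' [mK FK]] := F_exists K.
have [i' [p' [ip' _ _]]] := base_change_ses ip DM FK FP Fm.
exists K', P'; split; last by exists i', p'.
- exact: base_change_projective (F_base_change FP) hP.
- apply: IH FK _ hK; apply: D_sub (D_projective hP).
  by case: ip => h _ _; exact: h.
Qed.

Lemma base_change_hull k (M : lmodType R) (M' : lmodType S) (m : M -> M') :
  (forall N, D N) -> F m -> hull k M -> hull k M'.
Proof.
move=> DT Fm [L [G [hL hG [i [p ip]]]]].
have [L' [mL FL]] := F_exists L; have [G' [mG FG]] := F_exists G.
have [i' [p' [ip' _ _]]] := base_change_ses ip (DT G) Fm FL FG.
exists L', G'; split; last by exists i', p'.
- exact: base_change_pd_le FL (DT L) hL.
- exact: base_change_gproj FG hG.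
Qed.

End Semilinear.

(** * Polynomial extensions: the upper bound *)

(** Taking differences reduces uniqueness of values to the value at 0. This turns a diagram chase,
    such as the one defining a connecting map, into a linear map. *)
Lemma linear_graph (R : comPzRingType) (A B : lmodType R) (V : A -> B -> Prop) :
  (forall x, exists y, V x y) ->
  (forall a x y u v, V x u -> V y v -> V (a *: x + y) (a *: u + v)) ->
  (forall y, V 0 y -> y = 0) ->
  exists f : {linear A -> B}, forall x y, V x y -> f x = y.
Proof.
move=> /choice[f fV] VP V0.
have uniq x y z : V x y -> V x z -> y = z.
  move=> Vy Vz; have := VP (-1) _ _ _ _ Vy Vz; rewrite !scaleN1r !addNr.
  by move=> /V0 /eqP; rewrite addrC subr_eq0 => /eqP.
have [|g gE] := @mk_linear R A B f.
  by move=> a x y; apply: (uniq _ _ _ (fV _)); exact: VP.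
by exists g => x y Vxy; rewrite gE; exact: uniq (fV x) Vxy.
Qed.

(* S = R[X], described by what module theory sees of it: S is generated by R
   and X, and an S-module is an R-module with an arbitrary endomorphism. *)
Record polynomial_extension (R S : comPzRingType) := PolynomialExtension {
  const_map : {rmorphism R -> S};
  indet : S;
  eval0 : {rmorphism S -> R};
  eval0_coef : forall r, eval0 (const_map r) = r;
  eval0_indet : eval0 indet = 0;
  poly_generated : forall V : S -> Prop, (forall r, V (const_map r)) ->
    V indet -> (forall s t, V s -> V t -> V (s + t)) ->
    (forall s t, V s -> V t -> V (s * t)) -> forall s, V s;
  poly_action : forall (M : lmodType R) (x : {linear M -> M}),
    exists (N : lmodType S) (e : M -> N),
      [/\ bijective e, semilin const_map e & forall m, e (x m) = indet *: e m]
}.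

Section PolynomialExtension.
Variables (R S : comPzRingType) (E : polynomial_extension R S).
Let iota := const_map E.
Let X := indet E.
Let ev := eval0 E.

Lemma poly_linear (A B : lmodType S) (f : A -> B) :
  (forall r x y, f (iota r *: x + y) = iota r *: f x + f y) ->
  (forall x, f (X *: x) = X *: f x) ->
  exists g : {linear A -> B}, forall x, g x = f x.
Proof.
move=> hf fX; apply: mk_linear.
have fD x y : f (x + y) = f x + f y.
  by have := hf 1 x y; rewrite rmorph1 !scale1r.
have f0 : f 0 = 0 by apply: (addIr (f 0)); rewrite -fD !add0r.
have fr r x : f (iota r *: x) = iota r *: f x.
  by have := hf r x 0; rewrite f0 !addr0.
have fs : forall s x, f (s *: x) = s *: f x.
  apply: (poly_generated (p := E)) => //.
  - by move=> s t hs ht x; rewrite !scalerDl fD hs ht.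
  - by move=> s t hs ht x; rewrite -!scalerA hs ht.
by move=> s x y; rewrite fD fs.
Qed.

(** The kernel of [eval0] is XS, so scalars act on M/XM through [ev]. *)
Lemma eval0_split s : exists t, s = iota (ev s) + X * t.
Proof.
move: s; apply: (poly_generated (p := E)).
- by move=> r; exists 0; rewrite /ev eval0_coef mulr0 addr0.
- by exists 1; rewrite /ev eval0_indet rmorph0 add0r mulr1.
- move=> s t [s' sE] [t' tE]; exists (s' + t').
  by rewrite {1}sE {1}tE !rmorphD mulrDr addrACA.
- move=> s t [s' sE] [t' tE].
  exists (s' * t + iota (ev s) * t').
  rewrite {1}sE mulrDl {1}tE !rmorphM mulrDr mulrDr -!addrA; congr (_ + _).
  by rewrite addrC !mulrA [X * _ * t']mulrAC [X * t' * _]mulrC mulrA.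
Qed.

(* N = M[X], the function c giving the coefficients *)
Definition poly_coefs (M : lmodType R) (N : lmodType S) (m : M -> N)
    (c : N -> nat -> M) : Prop :=
  [/\ forall a x y i, c (iota a *: x + y) i = a *: c x i + c y i,
      forall x i, c (X *: x) i = if i is i'.+1 then c x i' else 0,
      forall x y, c x =1 c y -> x = y,
      forall f : nat -> M, (exists b, forall i, (b <= i)%N -> f i = 0) <->
        exists x, c x =1 f
    & forall x i, c (m x) i = if i is 0%N then x else 0].

Definition poly_module (M : lmodType R) (N : lmodType S) (m : M -> N) : Prop :=
  exists c, poly_coefs m c.

Definition finitely_supported (M : lmodType R) (f : nat -> M) : Prop :=
  exists b, forall i, (b <= i)%N -> f i = 0.

(** The common carrier of M[X] and M[X^-1], on which X acts by the two opposite shifts. *)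
Lemma finitely_supported_exists (M : lmodType R) :
  exists (N : lmodType R) (c : {linear N -> (nat -> M)}),
    injective c /\ forall f, finitely_supported f <-> exists x, c x = f.
Proof.
apply: submodule_exists; split; first by exists 0%N.
move=> a f g [b hb] [b' hb']; exists (maxn b b') => i; rewrite geq_max.
move=> /andP[/hb fi /hb' gi].
by rewrite /GRing.add /GRing.scale /= fi gi scaler0 addr0.
Qed.

Lemma poly_module_exists (M : lmodType R) :
  exists (N : lmodType S) (m : M -> N), poly_module m.
Proof.
have [B [c [cI cE]]] := finitely_supported_exists M.
have [|sh shE] := @mk_linear R (nat -> M) (nat -> M)
    (fun f i => if i is i'.+1 then f i' else 0).
  move=> a f g; apply/funext => -[|i] //=.
  by rewrite /GRing.add /GRing.scale /= scaler0 addr0.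
have [|x xE] := factor_inj (i := c) (f := sh \o c) cI.
  move=> f; apply/cE; have /cE[b hb] : exists x, c x = c f by exists f.
  by exists b.+1 => -[|i] // hi; rewrite /= shE hb.
have [N [e [[e' eK e'K] he eX]]] := poly_action E x.
have /choice[m0 m0E] : forall y : M, exists z,
    c z = (fun i => if i is 0%N then y else 0).
  by move=> y; apply/cE; exists 1%N => -[].
exists N, (e \o m0), (fun z => c (e' z)); split.
- by move=> a y z i; rewrite (semilin_inv he eK e'K) linearP.
- by move=> y i; rewrite -[y]e'K -eX eK xE /= shE e'K.
- by move=> y z /funext /cI /(congr1 e); rewrite !e'K.
- move=> f; split=> [/cE[y yf]|[y /funext yf]]; last by apply/cE; exists (e' y).
  by exists (e y); rewrite eK yf.
- by move=> y i; rewrite /= eK m0E.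
Qed.

Section PolyModule.
Variables (M : lmodType R) (N : lmodType S) (m : M -> N) (c : N -> nat -> M).
Hypothesis mc : poly_coefs m c.

Let cP a x y i : c (iota a *: x + y) i = a *: c x i + c y i.
Proof. by case: mc. Qed.
Let cX x i : c (X *: x) i = if i is i'.+1 then c x i' else 0.
Proof. by case: mc. Qed.
Let c_inj x y : c x =1 c y -> x = y.
Proof. by case: mc => _ _ h _ _; exact: h. Qed.
Let cm x i : c (m x) i = if i is 0%N then x else 0.
Proof. by case: mc. Qed.
Let c_surj f : finitely_supported f <-> exists x, c x =1 f.
Proof. by case: mc => _ _ _ h _; exact: h. Qed.

Lemma poly_coefD x y i : c (x + y) i = c x i + c y i.
Proof. by have := cP 1 x y i; rewrite rmorph1 !scale1r. Qed.

Lemma poly_coef0 i : c 0 i = 0.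
Proof. by apply: (addIr (c 0 i)); rewrite -poly_coefD !add0r. Qed.

Lemma poly_coefZ a x i : c (iota a *: x) i = a *: c x i.
Proof. by rewrite -[iota a *: x]addr0 cP poly_coef0 addr0. Qed.

Lemma poly_coefB x y i : c (x - y) i = c x i - c y i.
Proof.
by rewrite poly_coefD -scaleN1r -(rmorphN1 iota) poly_coefZ scaleN1r.
Qed.

Lemma poly_semilin : semilin iota m.
Proof.
move=> a x y; apply: c_inj => i; rewrite cP !cm.
by case: i => // i; rewrite scaler0 addr0.
Qed.

Lemma poly_coefs_finite x : finitely_supported (c x).
Proof. by apply/c_surj; exists x. Qed.

Lemma poly_decomp x : exists y, x = m (c x 0%N) + X *: y.
Proof.
have [b hb] := poly_coefs_finite x.
have /c_surj[y yE] : finitely_supported (fun i => c x i.+1).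
  by exists b => i hi; apply: hb; apply: leqW.
exists y; apply: c_inj => -[|i]; rewrite poly_coefD cX cm ?addr0 //.
by rewrite yE add0r.
Qed.

Lemma poly_module_ind (V : N -> Prop) :
  V 0 -> (forall x y, V y -> V (m x + X *: y)) -> forall y, V y.
Proof.
move=> V0 VS y; have [b] := poly_coefs_finite y.
elim: b y => [|b IH] y hb.
  by rewrite (_ : y = 0) //; apply: c_inj => i; rewrite hb // poly_coef0.
have [z zE] := poly_decomp y; rewrite zE; apply: VS; apply: IH => i hi.
by have := hb i.+1 hi; rewrite zE poly_coefD cX cm add0r.
Qed.

Lemma poly_base_change : base_change iota m.
Proof.
split; first exact: poly_semilin.
  move=> Q h hh.
  (* The factorization is the sum of the X^i h(c_i). All truncations [s k] beyond the support agree,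
     so values at different elements are compared under a common bound. *)
  pose s k x := \sum_(i < k) X ^+ i *: h (c x i).
  have sD k l x : (forall i, (k <= i)%N -> c x i = 0) -> (k <= l)%N ->
      s l x = s k x.
    move=> hk /subnK <-; elim: (l - k)%N => // n IH.
    rewrite addSn /s big_ord_recr /= -/(s _ x) IH hk ?leq_addl //.
    by rewrite (semilin0 hh) scaler0 addr0.
  have /choice[b bP] := poly_coefs_finite.
  have sE k x : (b x <= k)%N -> s (b x) x = s k x.
    by move=> hk; apply/esym/sD => //; exact: bP.
  have [||g gE] := @poly_linear N Q (fun x => s (b x) x).
  - move=> a x y; pose k := maxn (b (iota a *: x + y)) (maxn (b x) (b y)).
    rewrite !(sE k) ?leq_max ?leqnn ?orbT // /s scaler_sumr -big_split /=.
    apply: eq_bigr => i _; rewrite cP hh scalerDr !scalerA.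
    by rewrite [_ * iota a]mulrC.
  - move=> x; pose k := maxn (b (X *: x)) (b x).
    rewrite (sE k.+1) ?(sE k x) ?leqW ?leq_max ?leqnn ?orbT //.
    rewrite /s big_ord_recl cX (semilin0 hh) scaler0 add0r scaler_sumr.
    by apply: eq_bigr => i _; rewrite lift0 cX exprS scalerA.
  exists g => x; rewrite gE (sE (maxn (b (m x)) 1)) ?leq_maxl //.
  rewrite (sD 1%N) ?leq_maxr //; last by move=> [|i] // _; rewrite cm.
  by rewrite /s big_ord1 cm expr0 scale1r.
move=> Q g g' gg'; apply: poly_module_ind => [|x y gy].
  by rewrite !linear0.
by rewrite !linearD !linearZ /= gg' gy.
Qed.

End PolyModule.

Lemma poly_map_coef (A B : lmodType R) (A' B' : lmodType S) (mA : A -> A')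
    (mB : B -> B') cA cB (f : {linear A -> B}) (g : {linear A' -> B'}) :
  poly_coefs mA cA -> poly_coefs mB cB -> (forall x, g (mA x) = mB (f x)) ->
  forall y i, cB (g y) i = f (cA y i).
Proof.
move=> hA hB gE; have [_ XA _ _ cmA] := hA; have [_ XB _ _ cmB] := hB.
apply: (poly_module_ind hA) => [i|x y IH i].
  by rewrite linear0 (poly_coef0 hB) (poly_coef0 hA) linear0.
rewrite linearD linearZ /= gE (poly_coefD hB) (poly_coefD hA) XA XB cmA cmB.
by case: i => [|i]; rewrite linearD ?linear0 ?IH.
Qed.

(* The R-linear lift is read off from a lift to the coinduced modules
   Hom_R(S, A), which are sequences in A with the shift. *)
Lemma poly_restriction_projective (Q : lmodType S) (N : lmodType R)
    (e : N -> Q) :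
  bijective e -> semilin iota e -> projective Q -> projective N.
Proof.
move=> [e' eK e'K] he hQ A B p f pS.
have shift (M : lmodType R) : exists (M' : lmodType S) (w : (nat -> M) -> M'),
    [/\ bijective w, semilin iota w
      & forall u, w (fun i => u i.+1) = X *: w u].
  have [|sh shE] := @mk_linear R (nat -> M) (nat -> M) (fun u i => u i.+1).
    by [].
  have [M' [w [wB hw wX]]] := poly_action E sh.
  by exists M', w; split=> // u; rewrite -wX shE.
have [A' [a [[a' aK a'K] ha aX]]] := shift A.
have [B' [b [[b' bK b'K] hb bX]]] := shift B.
have [||p' p'E] := @poly_linear A' B' (fun x => b (fun i => p (a' x i))).
- move=> r x y; rewrite -hb; congr b; apply/funext => i.
  by rewrite (semilin_inv ha aK a'K) linearP.
- by move=> x; rewrite -bX -[x]a'K -aX !aK.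
have [||f' f'E] :=
    @poly_linear Q B' (fun x => b (fun i => f (e' (X ^+ i *: x)))).
- move=> r x y; rewrite -hb; congr b; apply/funext => i.
  rewrite scalerDr scalerA mulrC -scalerA.
  by rewrite (semilin_inv he eK e'K) linearP.
- move=> x; rewrite -bX; congr b; apply/funext => i.
  by rewrite scalerA -exprSr.
have [|g gE] := hQ _ _ p' f'.
  move=> y; have /choice[u uE] : forall i, exists x, p x = b' y i.
    by move=> i; exact: pS.
  exists (a u); rewrite p'E aK -[y]b'K; congr b; apply/funext => i.
  by rewrite uE.
have [|h hE] := @mk_linear R N A (fun x => a' (g (e x)) 0%N).
  by move=> r x y; rewrite he linearP (semilin_inv ha aK a'K).
exists h => x; rewrite hE.
have := gE (e x); rewrite p'E f'E => /(can_inj bK) /(congr1 (@^~ 0%N)) /= ->.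
by rewrite expr0 scale1r eK.
Qed.

(** R[X] is flat over R because induced maps act coefficientwise. The [True] is the trivial instance
    of the condition [D] on the quotient. *)
Lemma poly_module_inj (A B C : lmodType R) (A' B' : lmodType S)
    (i : {linear A -> B}) (p : {linear B -> C})
    (mA : A -> A') (mB : B -> B') (i' : {linear A' -> B'}) :
  ses i p -> True -> poly_module mA -> poly_module mB ->
  (forall x, i' (mA x) = mB (i x)) -> injective i'.
Proof.
move=> [iI _ _] _ [cA hA] [cB hB] iE; have ci := poly_map_coef hA hB iE.
apply: linear_inj0 => y iy; have [_ _ c_inj _ _] := hA.
apply: c_inj => k; rewrite (poly_coef0 hA); apply: (inj0 iI).
by rewrite -ci iy (poly_coef0 hB).
Qed.

Lemma poly_module_base_change (M : lmodType R) (N : lmodType S) (m : M -> N) :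
  poly_module m -> base_change iota m.
Proof. by case=> c /poly_base_change. Qed.

Lemma poly_module_hull k (M : lmodType R) (M' : lmodType S) (m : M -> M') :
  poly_module m -> hull k M -> hull k M'.
Proof.
apply: (base_change_hull (phi := iota) (F := poly_module)
  (D := fun=> True)) => //.
- exact: poly_module_base_change.
- exact: poly_module_exists.
- exact: poly_module_inj.
- move=> Q N e eB he hQ; exists 0%N.
  exact: poly_restriction_projective eB he hQ.
Qed.

(* 0 -> M[X] -> M[X] -> M -> 0, with first map multiplication by X - x, where
   x is the action of X on M *)
Lemma poly_characteristic_ses (M : lmodType S) (M0 : lmodType R) (e : M0 -> M)
    (N : lmodType S) (m : M0 -> N) :
  bijective e -> semilin iota e -> poly_module m -> ses_ex N N M.
Proof.
move=> [e' eK e'K] he [c hc]; have [_ univ uniq] := poly_base_change hc.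
have hm := poly_semilin hc; have [_ cX c_inj _ cm] := hc.
have [|x xE] := @mk_linear R M0 M0 (fun y => e' (X *: e y)).
  move=> a y z; rewrite he scalerDr scalerA [X * _]mulrC -scalerA.
  by rewrite (semilin_inv he eK e'K).
have [|u uE] := univ N (fun y => X *: m y - m (x y)).
  move=> a y z; rewrite linearP !hm scalerDr scalerA [X * _]mulrC -scalerA.
  by rewrite opprD addrACA scalerBr.
have [g gE] := univ M e he.
exists u, g; split.
- apply: linear_inj0 => y uy.
  have cu : forall y i, c (u y) i =
      (if i is i'.+1 then c y i' else 0) - x (c y i).
    apply: (poly_module_ind hc) => [i|z {uy}y IH i].
      rewrite linear0 !(poly_coef0 hc) linear0 subr0.
      by case: i => // i; rewrite (poly_coef0 hc).
    rewrite linearD linearZ /= uE /=.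
    rewrite (poly_coefD hc (_ - _)) (poly_coefB hc) !cX.
    case: i => [|i]; first by rewrite !(poly_coefD hc) !cX !cm !addr0.
    by rewrite IH !(poly_coefD hc) !cX !cm subr0 add0r addrA.
  (* Each coefficient is the image under [x] of the next, and all vanish from [b] on; descending
     induction kills them all. *)
  have {}cu i : c y i = x (c y i.+1).
    by apply/eqP; rewrite -subr_eq0 -(cu y i.+1) uy (poly_coef0 hc).
  have [b hb] := poly_coefs_finite hc y.
  have y0 n i : (b <= i + n)%N -> c y i = 0.
    elim: n i => [|n IH] i; first by rewrite addn0; exact: hb.
    by rewrite addnS -addSn => /IH ci; rewrite cu ci linear0.
  apply: c_inj => i; rewrite (poly_coef0 hc); apply: (y0 b); exact: leq_addl.
- by move=> y; exists (m (e' y)); rewrite gE e'K.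
- have gu : forall y, g (u y) = 0.
    apply: (uniq M (g \o u) \0) => y /=; rewrite uE linearB linearZ /= !gE xE.
    by rewrite e'K subrr.
  (* Division with remainder by X - x: modulo the image of [u] every element is a constant, and [g]
     is injective on constants. *)
  have dec : forall y, exists z w, y = m z + u w.
    apply: (poly_module_ind hc) => [|z y [z' [w ->]]].
      by exists 0, 0; rewrite linear0 (semilin0 hm) addr0.
    exists (z + x z'), (m z' + X *: w).
    rewrite [u (_ + _)]linearD [u (_ *: _)]linearZ /= uE /=.
    rewrite (semilinD hm) scalerDr -!addrA; congr (_ + _).
    rewrite addrCA; congr (_ + _).
    by rewrite addrA subrr add0r.
  move=> y; split=> [gy|[z <-]]; last exact: gu.
  have [z [w yE]] := dec y; exists w; rewrite yE.
  have : g y = 0 by []; rewrite yE linearD gu addr0 gE => ez.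
  rewrite (_ : z = 0) ?(semilin0 hm) ?add0r //.
  by rewrite -[z]eK ez -(semilin0 he) eK.
Qed.

Lemma hull_polynomial k :
  (forall M : lmodType R, hull k M) -> forall M : lmodType S, hull k.+1 M.
Proof.
move=> hR M; have [M0 [e [eB he]]] := restriction_exists iota M.
have [N [m Fm]] := poly_module_exists M0.
have hN := poly_module_hull Fm (hR M0).
exact: hull_cokernel (poly_characteristic_ses eB he Fm) hN (hullS hN).
Qed.

End PolynomialExtension.

(** * Reduction modulo X: the lower bound *)

Section Reduction.
Variables (R S : comPzRingType) (E : polynomial_extension R S).
Let iota := const_map E.
Let X := indet E.
Let ev := eval0 E.

Definition torsion_free (M : lmodType S) : Prop :=
  forall x : M, X *: x = 0 -> x = 0.

Definition reduction (M : lmodType S) (N : lmodType R) (m : M -> N) : Prop :=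
  [/\ semilin ev m, surjective m & forall x, m x = 0 <-> exists y, x = X *: y].

Lemma torsion_free_sub (A B : lmodType S) (i : {linear A -> B}) :
  injective i -> torsion_free B -> torsion_free A.
Proof.
move=> iI hB x Xx; apply: (inj0 iI); apply: hB.
by rewrite -linearZ Xx linear0.
Qed.

(** The canonical surjection P0[X] -> P, with [P0] the restriction of [P], splits; and X is
    injective on P0[X]. *)
Lemma projective_torsion_free (P : lmodType S) : projective P -> torsion_free P.
Proof.
move=> hP; have [P0 [e [[e' eK e'K] he]]] := restriction_exists iota P.
have [P' [m [c hc]]] := poly_module_exists E P0.
have [hm univ _] := poly_base_change hc.
have [g gE] := univ P e he.
have [|s sE] := hP _ _ g idfun.
  by move=> y; exists (m (e' y)); rewrite gE e'K.
move=> x Xx; rewrite -[x]sE; have [_ cX c_inj _ _] := hc.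
rewrite (_ : s x = 0) ?linear0 //; apply: c_inj => i.
by rewrite -(cX (s x) i.+1) -linearZ Xx linear0 !(poly_coef0 hc).
Qed.

Lemma reduction_exists (M : lmodType S) :
  exists (N : lmodType R) (m : M -> N), reduction m.
Proof.
have [|W [p [pS pE]]] := @quotient_exists S M (fun x => exists y, x = X *: y).
  split=> [|a _ _ [x ->] [y ->]]; first by exists 0; rewrite scaler0.
  by exists (a *: x + y); rewrite scalerDr !scalerA mulrC.
have [N [e [[e' eK e'K] he]]] := restriction_exists iota W.
have eI : e' 0 = 0 by apply: (can_inj eK); rewrite e'K (semilin0 he).
exists N, (e' \o p); split=> [s x y|n|x] /=.
- have [t sE] := eval0_split E s.
  rewrite linearP -(semilin_inv he eK e'K) /=; congr (e' (_ + _)).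
  rewrite {1}sE scalerDl -[RHS]addr0; congr (_ + _).
  rewrite -scalerA -[t *: _]linearZ -[X *: _]linearZ; apply/pE.
  by exists (t *: x).
- by have [x px] := pS (e n); exists x; rewrite px eK.
- rewrite -pE -eI; split=> [/(can_inj e'K) //|->]; by [].
Qed.

Lemma reduction_base_change (M : lmodType S) (N : lmodType R) (m : M -> N) :
  reduction m -> base_change ev m.
Proof.
move=> [hm mS mE]; split=> // [Q h hh|Q g g' gg' y]; last first.
  by have [x <-] := mS y; exact: gg'.
have /choice[s sK] := mS.
have hs x y : m x = m y -> h x = h y.
  move=> e; apply/eqP; rewrite -subr_eq0 -(semilinB hh).
  have /mE[z ->] : m (x - y) = 0 by rewrite (semilinB hm) e subrr.
  by rewrite (semilinZ hh) /ev eval0_indet scale0r.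
have [|g gE] := @mk_linear R N Q (fun n => h (s n)).
  move=> a x y; rewrite -[a in RHS](eval0_coef E) -hh; apply: hs.
  by rewrite hm !sK /ev eval0_coef.
by exists g => x; rewrite gE; apply: hs; rewrite sK.
Qed.

(** The obstruction to injectivity is Tor_1(C, S/X), which is the X-torsion of [C]. *)
Lemma reduction_inj (A B C : lmodType S) (A' B' : lmodType R)
    (i : {linear A -> B}) (p : {linear B -> C})
    (mA : A -> A') (mB : B -> B') (i' : {linear A' -> B'}) :
  ses i p -> torsion_free C -> reduction mA -> reduction mB ->
  (forall x, i' (mA x) = mB (i x)) -> injective i'.
Proof.
move=> s hC [hA AS AE] [hB BS BE] iE; have [iI _ ip] := s.
apply: linear_inj0 => a'; have [a <-] := AS a'; rewrite iE => /BE[b ib].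
have /hC /ip[a1 ia1] : X *: p b = 0 by rewrite -linearZ -ib (ses0 s).
by apply/AE; exists a1; apply: iI; rewrite linearZ /= ia1.
Qed.

(* Over R[X], a projective R-module Q has the resolution
   0 -> Q[X] --X--> Q[X] -> Q -> 0. *)
Lemma reduction_restriction_pd (Q : lmodType R) (N : lmodType S) (e : N -> Q) :
  bijective e -> semilin ev e -> projective Q -> exists k, pd_le k N.
Proof.
move=> [e' eK e'K] he hQ; exists 1%N.
have [Q' [m Fm]] := poly_module_exists E Q; have [c hc] := Fm.
have [hm univ _] := poly_base_change hc; have [_ cX c_inj c_surj cm] := hc.
have hQ' : projective Q'.
  exact: base_change_projective (poly_base_change hc) hQ.
have XN (x : N) : X *: x = 0.
  apply: (can_inj eK); rewrite (semilinZ he) /ev eval0_indet scale0r.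
  by rewrite (semilin0 he).
have [|g gE] := univ N e'.
  move=> a x y; apply: (can_inj eK).
  by rewrite he !e'K /ev eval0_coef.
have g0 y : g y = e' (c y 0%N).
  have [z {1}->] := poly_decomp hc y.
  by rewrite linearD linearZ /= XN addr0 gE.
have [|u uE] := @mk_linear S Q' Q' (fun y => X *: y).
  by move=> a x y; rewrite scalerDr !scalerA mulrC.
exists Q', Q'; split=> //; exists u, g; split.
- move=> x y; rewrite !uE => exy; apply: c_inj => i.
  by rewrite -(cX x i.+1) exy cX.
- by move=> y; exists (m (e y)); rewrite gE eK.
- have e'0 : e' 0 = 0 by rewrite -(semilin0 he) eK.
  move=> y; rewrite g0; split=> [gy|[x <-]]; last by rewrite uE cX.
  have c0 : c y 0%N = 0 by apply: (can_inj e'K); rewrite gy e'0.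
  have [z ->] := poly_decomp hc y; exists z.
  by rewrite uE c0 (semilin0 hm) add0r.
Qed.

Lemma reduction_gproj (G : lmodType S) (G' : lmodType R) (m : G -> G') :
  reduction m -> gproj G -> gproj G'.
Proof.
apply: (base_change_gproj (phi := ev) (F := reduction) (D := torsion_free)).
- exact: reduction_base_change.
- exact: reduction_exists.
- exact: reduction_inj.
- exact: torsion_free_sub.
- exact: projective_torsion_free.
- exact: reduction_restriction_pd.
Qed.

Lemma reduction_pd_le k (M : lmodType S) (M' : lmodType R) (m : M -> M') :
  reduction m -> torsion_free M -> pd_le k M -> pd_le k M'.
Proof.
apply: (base_change_pd_le (phi := ev) (F := reduction) (D := torsion_free)).
- exact: reduction_base_change.
- exact: reduction_exists.
- exact: reduction_inj.
- exact: torsion_free_sub.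
- exact: projective_torsion_free.
Qed.

Lemma gproj_torsion_free (G : lmodType S) : gproj G -> torsion_free G.
Proof.
case/gproj_complete=> _ [P [_ [hP _ [i [_ [iI _ _]]]]]] _.
exact: torsion_free_sub iI (projective_torsion_free hP).
Qed.

(* M[X^-1]: the finitely supported sequences, on which X acts as the shift,
   surjectively and with kernel M *)
Lemma inverse_polynomials_exist (M : lmodType R) :
  exists (N : lmodType S) (m : M -> N),
    [/\ semilin iota m, injective m,
        forall y : N, exists z, y = X *: z
      & forall y : N, X *: y = 0 <-> exists x, y = m x].
Proof.
have [B [c [cI cE]]] := finitely_supported_exists M.
have [|sh shE] := @mk_linear R (nat -> M) (nat -> M) (fun f i => f i.+1).
  by [].
have [|x xE] := factor_inj (i := c) (f := sh \o c) cI.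
  move=> f; apply/cE; have /cE[b hb] : exists x, c x = c f by exists f.
  by exists b => i hi; rewrite /= shE hb // leqW.
have [N [e [[e' eK e'K] he eX]]] := poly_action E x.
have [|d dE] :=
    @mk_linear R M (nat -> M) (fun y i => if i is 0%N then y else 0).
  move=> a y z; apply/funext => -[|i] //.
  by rewrite /GRing.add /GRing.scale /= scaler0 addr0.
have [|m0 m0E] := factor_inj (i := c) (f := d) cI.
  by move=> y; apply/cE; exists 1%N; rewrite dE => -[].
exists N, (e \o m0); split.
- exact: semilin_compr.
- move=> y z /= /(can_inj eK) /(congr1 c) /(congr1 (@^~ 0%N)).
  by rewrite !m0E !dE.
- move=> y.
  have [z zE] :
      exists z, c z = fun i => if i is i'.+1 then c (e' y) i' else 0.
    apply/cE; have /cE[b hb] : exists x, c x = c (e' y) by exists (e' y).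
    by exists b.+1 => -[|i] // hi; exact: hb.
  exists (e z); rewrite -eX -[LHS]e'K; congr e; apply: cI.
  by rewrite xE /= shE zE.
- have e0 : e 0 = 0 by exact: semilin0 he.
  move=> y; rewrite -[y]e'K -eX -e0.
  split=> [/(can_inj eK) xy|[z /(can_inj eK) ->]].
    exists (c (e' y) 0%N); congr e; apply: cI; rewrite m0E dE.
    apply/funext => -[|i] //.
    have := congr1 (@^~ i) (xE (e' y)); rewrite /= shE xy linear0 => <-.
    by [].
  by congr e; apply: cI; rewrite xE /= shE m0E dE linear0.
Qed.

(** The snake lemma for multiplication by X on [K -> P -> L], with the cokernel of [M -> K']
    identified as the kernel [C] of [P' -> G']. *)
Lemma hull_of_polynomial k :
  (forall M : lmodType S, hull k.+1 M) -> forall M : lmodType R, hull k M.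
Proof.
move=> hS M; have [N [m [hm mI NX Nm]]] := inverse_polynomials_exist M.
have [L [G [[K [P [hP hK [i [p ip]]]]] hG [j [q jq]]]]] := hS N.
have tG := gproj_torsion_free hG; have tP := projective_torsion_free hP.
have [iI pS ipE] := ip; have [jI qS jqE] := jq.
have tK := torsion_free_sub iI tP.
have [K' [mK FK]] := reduction_exists K.
have [P' [mP FP]] := reduction_exists P.
have [G' [mG FG]] := reduction_exists G.
have [hmK mKS mKE] := FK; have [hmP mPS mPE] := FP; have [hmG mGS mGE] := FG.
have bK := reduction_base_change FK; have bP := reduction_base_change FP.
have [i' i'E] := base_change_map i bK hmP.
have [r' r'E] := base_change_map (q \o p) bP hmG.
have [|C [u ur]] := @kernel_ses _ _ _ r'.
  move=> g'; have [g <-] := mGS g'; have [l <-] := qS g; have [x <-] := pS l.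
  by exists (mP x); rewrite r'E.
have [uI _ urE] := ur.
have hC : gproj C.
  apply: gproj_kernel (reduction_gproj FG hG); first by exists u, r'.
  exact: base_change_projective bP hP.
have [|v vE] := factor_inj (i := u) (f := i') uI.
  move=> z; apply/urE; have [x <-] := mKS z.
  by rewrite i'E r'E /= (ses0 ip) linear0 (semilin0 hmG).
exists K', C; split=> //; first exact: reduction_pd_le FK tK hK.
(* The connecting map as a relation: lift [j (m x)] to [P], multiply by X, read the result in [K],
   reduce modulo X. *)
pose V x z := exists k l, [/\ mK k = z, i k = X *: l & p l = j (m x)].
have [x|a x y _ _ [k1 [l1 [<- ik1 pl1]]] [k2 [l2 [<- ik2 pl2]]]|z|w wE] :=
  @linear_graph R M K' V.
- have [l pl] := pS (j (m x)).
  have /ipE[k' ik] : p (X *: l) = 0.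
    rewrite linearZ /= pl -linearZ (_ : X *: _ = 0) ?linear0 //.
    by apply/Nm; exists x.
  by exists (mK k'), k', l.
- exists (iota a *: k1 + k2), (iota a *: l1 + l2); split.
  + by rewrite hmK /ev eval0_coef.
  + by rewrite linearP ik1 ik2 scalerDr !scalerA mulrC.
  + by rewrite linearP pl1 pl2 hm linearP.
- move=> [k1 [l [<- ik1]]]; rewrite (semilin0 hm) linear0 => /ipE[k2 ik2].
  by apply/mKE; exists k2; apply: iI; rewrite linearZ /= ik2.
have wV x : exists k l, [/\ mK k = w x, i k = X *: l & p l = j (m x)].
  have [l pl] := pS (j (m x)).
  have /ipE[k' ik] : p (X *: l) = 0.
    rewrite linearZ /= pl -linearZ (_ : X *: _ = 0) ?linear0 //.
    by apply/Nm; exists x.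
  have Vx : V x (mK k') by exists k', l.
  by exists k', l; rewrite (wE _ _ Vx).
exists w, v; split.
- apply: linear_inj0 => x wx; have [k1 [l [kw ik pl]]] := wV x.
  move: kw; rewrite wx => /mKE[k2 k12].
  have l2 : l = i k2.
    apply/eqP; rewrite -subr_eq0; apply/eqP/tP.
    by rewrite scalerBr -ik k12 linearZ subrr.
  move: pl; rewrite l2 (ses0 ip) => /esym /(inj0 jI) mx.
  by apply: mI; rewrite mx (semilin0 hm).
- move=> z; have [y yz] := mPS (u z).
  have /mGE[g rg] : mG (q (p y)) = 0.
    by rewrite -[q _]/((q \o p) y) -r'E yz (ses0 ur).
  have [l ql] := qS g; have [y1 py1] := pS l.
  have /jqE[n jn] : q (p (y - X *: y1)) = 0.
    rewrite [p _]linearB [q _]linearB [p (X *: _)]linearZ.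
    by rewrite [q (X *: _)]linearZ /= py1 ql rg subrr.
  (* Divisibility of [N] absorbs the remaining term, so that [y] is congruent modulo X to an element
     of [K]. *)
  have [n1 n1E] := NX n; have [y2 py2] := pS (j n1).
  have /ipE[k1 ik] : p (y - X *: (y1 + y2)) = 0.
    rewrite scalerDr opprD addrA linearB -jn n1E linearZ [p (_ *: _)]linearZ.
    by rewrite /= py2 subrr.
  exists (mK k1); apply: uI; rewrite vE i'E ik (semilinB hmP) yz.
  rewrite (_ : mP (X *: _) = 0) ?subr0 //; apply/mPE; by exists (y1 + y2).
- move=> z; have [k1 kz] := mKS z; split=> [vz|[x <-]].
    have /mPE[l il] : mP (i k1) = 0 by rewrite -i'E kz -vE vz linear0.
    (* Torsion-freeness of [G] puts [p l] into [N], where the X-torsion is [M]. *)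
    have /tG/jqE[n jn] : X *: q (p l) = 0.
      by rewrite -!linearZ -il (ses0 ip) linear0.
    have /Nm[x nx] : X *: n = 0.
      by apply: (inj0 jI); rewrite linearZ /= jn -linearZ -il (ses0 ip).
    by exists x; apply: wE; exists k1, l; rewrite -nx jn.
  have [k2 [l [<- ik pl]]] := wV x.
  apply: (inj0 uI); rewrite vE i'E; apply/mPE; by exists l.
Qed.

(** A hull of dimension 0 would embed R[X^-1] in a projective module, but it has X-torsion [R]. This
    settles the case where no degree is left to subtract. *)
Lemma not_hull0_polynomial : 1 != 0 :> R -> ~ forall M : lmodType S, hull 0 M.
Proof.
move=> R1 hS; have [N [m [hm mI NX Nm]]] := inverse_polynomials_exist (R^o).
have [L [_ [hL _ [i [_ [iI _ _]]]]]] := hS N.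
have tN := torsion_free_sub iI (projective_torsion_free hL).
case/eqP: R1; apply: mI; rewrite (semilin0 hm); apply: tN.
by apply/Nm; exists 1.
Qed.

End Reduction.

(** * R[X_1, ..., X_n+1] as a polynomial extension *)

Section PolyAction.
Variables (A : comNzRingType) (M : lmodType A) (x : {linear M -> M}).

Implicit Types (p q : {poly A}) (a : A) (y z : M).

Definition poly_act (p : {poly A}) (y : M) : M :=
  \sum_(i < size p) p`_i *: iter i x y.

Lemma poly_act_widen k p y : (size p <= k)%N ->
  poly_act p y = \sum_(i < k) p`_i *: iter i x y.
Proof.
move=> hk; rewrite /poly_act (big_ord_widen k (fun i => p`_i *: iter i x y)) //.
rewrite big_mkcond; apply: eq_bigr => i _; case: ltnP => // /leq_sizeP -> //.
by rewrite scale0r.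
Qed.

Lemma poly_actP a p q y :
  poly_act (a *: p + q) y = a *: poly_act p y + poly_act q y.
Proof.
pose k := maxn (size (a *: p + q)) (maxn (size p) (size q)).
rewrite !(@poly_act_widen k) ?leq_max ?leqnn ?orbT // scaler_sumr -big_split /=.
by apply: eq_bigr => i _; rewrite coefD coefZ scalerDl scalerA.
Qed.

Lemma poly_actD p q y : poly_act (p + q) y = poly_act p y + poly_act q y.
Proof. by rewrite -{1}[p]scale1r poly_actP scale1r. Qed.

Lemma iter_linear i a y z :
  iter i x (a *: y + z) = a *: iter i x y + iter i x z.
Proof. by elim: i => //= i ->; rewrite linearP. Qed.

Lemma poly_act_linear p a y z :
  poly_act p (a *: y + z) = a *: poly_act p y + poly_act p z.
Proof.
rewrite /poly_act scaler_sumr -big_split; apply: eq_bigr => i _ /=.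
by rewrite iter_linear scalerDr !scalerA mulrC.
Qed.

Lemma poly_actC a y : poly_act a%:P y = a *: y.
Proof.
by rewrite (@poly_act_widen 1) ?size_polyC_leq1 // big_ord1 coefC.
Qed.

Lemma poly_actMX p y : poly_act (p * 'X) y = x (poly_act p y).
Proof.
rewrite (@poly_act_widen (size p).+1); last first.
  by rewrite (leq_trans (size_polyMleq _ _)) // size_polyX addn2.
rewrite big_ord_recl coefMX scale0r add0r /poly_act linear_sum /=.
by apply: eq_bigr => i _; rewrite coefMX /bump leq0n add1n /= linearZ.
Qed.

Lemma poly_actX y : poly_act 'X y = x y.
Proof. by rewrite -['X]mul1r poly_actMX -polyC1 poly_actC scale1r. Qed.

Lemma poly_actM p q y : poly_act (p * q) y = poly_act p (poly_act q y).
Proof.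
elim/poly_ind: p => [|p a IH].
  by rewrite mul0r /poly_act size_poly0 !big_ord0.
rewrite mulrDl !poly_actD mulrAC !poly_actMX IH poly_actC; congr (_ + _).
rewrite mul_polyC -[a *: q]addr0 poly_actP {2}/poly_act size_poly0.
by rewrite big_ord0 addr0.
Qed.

(** The ring [S] over {poly A} is a parameter so that a ring of multivariate polynomials acts
    directly, through [theta]. *)
Lemma poly_act_module (S : comPzRingType) (theta : {rmorphism S -> {poly A}}) :
  exists (N : lmodType S) (e : M -> N),
    [/\ bijective e, forall y z, e (y + z) = e y + e z
      & forall s y, e (poly_act (theta s) y) = s *: e y].
Proof.
apply: (lmod_of_ops (zero := 0) (opp := -%R)).
- exact: addrA.
- exact: addrC.
- exact: add0r.
- exact: addNr.
- by move=> s t y; rewrite rmorphM poly_actM.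
- by move=> y; rewrite rmorph1 poly_actC scale1r.
- by move=> s y z; rewrite -[y]scale1r poly_act_linear !scale1r.
- by move=> y s t; rewrite rmorphD poly_actD.
Qed.

End PolyAction.

Lemma mpoly_generated (A : comNzRingType) n (V : mpoly n A -> Prop) :
  (forall a, V (mpolyC n a)) -> (forall i, V (mpolyX A (mnm1 i))) ->
  (forall p q, V p -> V q -> V (p + q)) ->
  (forall p q, V p -> V q -> V (p * q)) -> forall p, V p.
Proof.
move=> VC VX VD VM p.
have V0 : V 0 by rewrite -(mpolyC0 n A).
have V1 : V 1 by rewrite -(mpolyC1 n A).
rewrite [p]mpolyE; apply: (big_ind V V0 VD) => m _.
rewrite -mul_mpolyC; apply: (VM) => //; rewrite mpolyXE_id.
apply: (big_ind V V1 VM) => i _.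
by elim: (m i) => [|k IH]; rewrite ?expr0 // exprS; apply: (VM).
Qed.

Section MpolyExtension.
Variables (A : comNzRingType) (n : nat).
Let S := mpoly n A.
Let T := mpoly n.+1 A.

Let h (i : 'I_n.+1) : {poly S} :=
  if unlift ord_max i is Some j then (mpolyX A (mnm1 j))%:P else 'X.

Let theta : {rmorphism T -> {poly S}} := mmap (polyC \o mpolyC n (R := A)) h.

Let thetaX i : theta (mpolyX A (mnm1 i)) = h i.
Proof. by rewrite /theta /= mmapX mmap1U. Qed.

Let mwiden_X i :
  mwiden (mpolyX A (mnm1 i)) = mpolyX A (mnm1 (lift (ord_max : 'I_n.+1) i)).
Proof.
rewrite mwidenX mnmwiden1; congr (mpolyX _ (mnm1 _)).
by apply: val_inj; rewrite /= /bump leqNgt ltn_ord.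
Qed.

Let theta_widen p : theta (mwiden p) = p%:P.
Proof.
move: p; apply: mpoly_generated => [a|i|p q hp hq|p q hp hq].
- by rewrite mwidenC /theta /= mmapC.
- by rewrite mwiden_X thetaX /h liftK.
- by rewrite mwidenD rmorphD /= hp hq polyCD.
- by rewrite mwidenM rmorphM /= hp hq polyCM.
Qed.

(** Through [theta], elements of [T] become polynomials in the last indeterminate over [S]; [eval0]
    takes the constant term, and [T] acts on [M] by evaluation at the endomorphism. *)
Lemma mpoly_extension : inhabited (polynomial_extension S T).
Proof.
pose X : T := mpolyX A (mnm1 ord_max).
have thX : theta X = 'X by rewrite thetaX /h unlift_none.
split; apply: (@PolynomialExtension S T (mwiden (n := n) (R := A)) X
  (horner_eval 0 \o theta)).
- by move=> p; rewrite /= theta_widen /horner_eval hornerC.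
- by rewrite /= thX /horner_eval hornerX.
- move=> V VC VX VD VM; apply: mpoly_generated => // [a|i].
    by rewrite -mwidenC; exact: VC.
  by case: (unliftP ord_max i) => [j|] -> //; rewrite -mwiden_X; exact: VC.
- move=> M x; have [N [e [eB eD eZ]]] := poly_act_module x theta.
  exists N, e; split=> // [p y z|y].
    by rewrite eD -eZ theta_widen poly_actC.
  by rewrite -eZ thX poly_actX.
Qed.

End MpolyExtension.

(** * Global dimension *)

Lemma bijective_base_change (R S : comPzRingType) (phi : {rmorphism R -> S})
    (psi : {rmorphism S -> R}) (M : lmodType R) (N : lmodType S) (m : M -> N) :
  cancel psi phi -> semilin phi m -> bijective m -> base_change phi m.
Proof.
move=> psiK hm [m' mK m'K]; split=> // [Q h hh|Q g g' gg' y]; last first.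
  by rewrite -[y]m'K; exact: gg'.
have [|g gE] := @mk_linear S N Q (h \o m').
  move=> s y z; rewrite /= -{1}[s]psiK (semilin_inv hm mK m'K).
  by rewrite hh psiK.
by exists g => x; rewrite gE /= mK.
Qed.

(** Bijective semilinear maps are base changes along an isomorphism, so [base_change_hull] applies.
    This serves polynomials in no indeterminates, a ring isomorphic but not equal to the base. *)
Lemma ring_isomorphism_hull (R S : comPzRingType) (phi : {rmorphism R -> S})
    (psi : {rmorphism S -> R}) k :
  cancel phi psi -> cancel psi phi ->
  (forall M : lmodType R, hull k M) -> forall M : lmodType S, hull k M.
Proof.
move=> phiK psiK hR M; have [M0 [e [eB he]]] := restriction_exists phi M.
have semilin_iso_inv (R' S' : comPzRingType) (f : {rmorphism R' -> S'})
    (g : {rmorphism S' -> R'}) (A : lmodType R') (B : lmodType S')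
    (m : A -> B) (m' : B -> A) :
    cancel g f -> semilin f m -> cancel m m' -> cancel m' m -> semilin g m'.
  move=> gK hm mK m'K s x y.
  by rewrite -{1}[s]gK (semilin_inv hm mK m'K).
apply: (@base_change_hull R S phi
  (fun A B m => semilin phi m /\ bijective m) (fun=> True)
  _ _ _ _ _ _ k M0 M e) => //.
- by move=> A B m [hm mB]; exact: bijective_base_change psiK hm mB.
- move=> A; have [N [m [[m' mK m'K] hm]]] := restriction_exists psi A.
  exists N, m'; split; last by exists m.
  exact: semilin_iso_inv phiK hm mK m'K.
- move=> A B C A' B' i p mA mB i' [iI _ _] _.
  move=> [hA [mA' AK A'K]] [hB [mB' BK _]] iE.
  apply: linear_inj0 => y; rewrite -[y]A'K iE -(semilin0 hB).
  by move=> /(can_inj BK) /(inj0 iI) ->; rewrite (semilin0 hA).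
- move=> Q N m [m' mK m'K] hm hQ; exists 0%N.
  apply: base_change_projective hQ.
  apply: (bijective_base_change (psi := phi) (m := m') (phi := psi)) => //.
    exact: semilin_iso_inv psiK hm mK m'K.
  by exists m.
Qed.

Section GorensteinGlobalDimension.
Variable R : comPzRingType.
Implicit Type M : lmodType R.

Lemma hull_le j k M : (j <= k)%N -> hull j M -> hull k M.
Proof. by move=> /subnK <-; elim: (k - j)%N => // n IH /IH; exact: hullS. Qed.

Lemma hullP k M : gorenstein_resolution M k <-> hull k M.
Proof.
rewrite gorenstein_resolutionP; split; first exact: gp_resolution_hull.
exact: hull_gp_resolution.
Qed.

Lemma least_nat (V : nat -> Prop) :
  (exists k, V k) -> exists k, V k /\ forall j, V j -> (k <= j)%N.
Proof.
move=> [k Vk]; have ex : exists k, `[< V k >] by exists k; apply/asboolP.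
case: (ex_minnP ex) => m /asboolP Vm hm; exists m; split=> // j Vj.
by apply: hm; apply/asboolP.
Qed.

Lemma zero_hull k M : (forall x : M, x = 0) -> hull k M.
Proof.
by move=> M0; apply/gproj_hull/projective_gproj/zero_module_projective.
Qed.

Lemma Gpd_cases M :
  [\/ (forall x : M, x = 0) /\ Gpd M = -oo%E,
      exists k, [/\ hull k M, forall j, hull j M -> (k <= j)%N
                  & Gpd M = k%:Z%:E]
    | (forall k, ~ hull k M) /\ Gpd M = +oo%E].
Proof.
rewrite /Gpd; case: asboolP => hM; first by apply: Or31.
have [/least_nat[k [hk mk]]|nh] := pselect (exists k, hull k M).
  apply: Or32; exists k; split=> //; apply: xget_unique.
    by exists k => //=; split=> [|j /hullP]; [apply/hullP|exact: mk].
  move=> _ [j [/hullP hj mj] <-]; congr (_%:Z%:E); apply/eqP.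
  by rewrite eqn_leq mk // mj //; apply/hullP.
apply: Or33; split=> [k hk|]; first by apply: nh; exists k.
by apply: xgetPN => _ [j [/hullP hj _] _]; apply: nh; exists j.
Qed.

Lemma Gpd_le k M : (Gpd M <= k%:Z%:E)%E <-> hull k M.
Proof.
case: (Gpd_cases M) => [[M0 ->]|[j [hj mj ->]]|[nh ->]].
- by split=> // _; exact: zero_hull.
- by rewrite lee_fin lez_nat; split=> [jk|/mj //]; exact: hull_le jk hj.
- by split=> [|/nh //]; rewrite leye_eq.
Qed.

Let Gpds : set (\bar int) := [set g | exists M, g = Gpd M]%classic.

Lemma G_gldim_eq v :
  (forall M, (Gpd M <= v)%E) ->
  (forall w, (forall M, (Gpd M <= w)%E) -> (v <= w)%E) -> G_gldim R = v.
Proof.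
move=> ub lub; rewrite /G_gldim -/Gpds /supremum.
have sup : supremums Gpds v.
  split=> [_ [M ->] //|w hw]; apply: lub => M; by apply: hw; exists M.
(* On the empty set [supremum] returns its default value; the regular module shows that the set of
   dimensions is nonempty. *)
case: eqP => [e|_]; last first.
  by apply: xget_unique => // w hw; exact: is_subset1_supremums hw sup.
have : Gpds (Gpd (R^o : lmodType R)) by exists R^o.
by rewrite e.
Qed.

Lemma G_gldim_trivial : 1 = 0 :> R -> G_gldim R = -oo%E.
Proof.
move=> R0; apply: G_gldim_eq => [M|w _]; last exact: leNye.
rewrite /Gpd; case: asboolP => // -[] x.
by rewrite -[x]scale1r R0 scale0r.
Qed.

(** The regular module is nonzero, so its dimension is at least 0; this excludes -oo and the
    negative integers as bounds. *)
Lemma Gpd_upper_bound v : 1 != 0 :> R -> (forall M, (Gpd M <= v)%E) ->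
  v = +oo%E \/ exists k, v = k%:Z%:E /\ forall M, hull k M.
Proof.
move=> R1 hv; case: v hv => [z| |] hv; [|by left|]; last first.
  have := hv R^o; case: (Gpd_cases (R^o : lmodType R)).
  - by case=> /(_ 1) e; rewrite e eqxx in R1.
  - by move=> [k [_ _ ->]].
  - by move=> [_ ->].
have [z' zE] : exists z', z = Posz z'.
  have := hv R^o; case: (Gpd_cases (R^o : lmodType R)).
  - by case=> /(_ 1) e; rewrite e eqxx in R1.
  - by move=> [k [_ _ ->]]; rewrite lee_fin; case: z {hv} => // n _; exists n.
  - by move=> [_ ->].
by right; exists z'; rewrite zE; split=> // M; apply/Gpd_le; rewrite -zE.
Qed.

Lemma G_gldim_cases : 1 != 0 :> R ->
  (exists k, [/\ forall M, hull k M,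
                 forall j, (forall M, hull j M) -> (k <= j)%N
               & G_gldim R = k%:Z%:E])
  \/ (forall k, ~ forall M, hull k M) /\ G_gldim R = +oo%E.
Proof.
move=> R1.
have [/least_nat[k [hk mk]]|nh] := pselect (exists k, forall M, hull k M).
  left; exists k; split=> //; apply: G_gldim_eq => [M|v]; first exact/Gpd_le.
  case/(Gpd_upper_bound R1) => [->|[j [-> hj]]]; first exact: leey.
  by rewrite lee_fin lez_nat; exact: mk.
right; split=> [k hk|]; first by apply: nh; exists k.
apply: G_gldim_eq => [M|v]; first exact: leey.
case/(Gpd_upper_bound R1) => [-> //|[j [_ hj]]].
by case: nh; exists j.
Qed.

End GorensteinGlobalDimension.

Lemma mpoly0_hull (A : comNzRingType) k :
  (forall M : lmodType (mpoly 0 A), hull k M) <->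
  forall M : lmodType A, hull k M.
Proof.
pose phi : {rmorphism A -> mpoly 0 A} := mpolyC 0 (R := A).
pose psi : {rmorphism mpoly 0 A -> A} := mcoeff (@mnm0 0).
have phiK : cancel phi psi by exact: mpolyCK.
have psiK : cancel psi phi.
  move=> p; apply/mpolyP => m; rewrite /phi /= mcoeffC.
  have -> : m = (@mnm0 0) by apply/mnmP => -[].
  by rewrite eqxx mulr1.
split; exact: ring_isomorphism_hull.
Qed.

(** The clause [n <= k] guards the truncated subtraction; in the induction it is secured by
    [not_hull0_polynomial]. *)
Lemma mpoly_hull (A : comNzRingType) n k :
  (forall M : lmodType (mpoly n A), hull k M) <->
  (n <= k)%N /\ forall M : lmodType A, hull (k - n) M.
Proof.
elim: n k => [|n IH] k.
  by rewrite subn0 mpoly0_hull; split=> [|[]].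
have [E] := mpoly_extension A n.
case: k => [|k].
  split=> [|[]//] h; exfalso.
  exact: (@not_hull0_polynomial _ _ E (oner_neq0 _) h).
rewrite subSS ltnS -IH; split; first exact: hull_of_polynomial.
exact: hull_polynomial.
Qed.

Theorem theorem2p1 (R : comPzRingType) (n : nat) :
  G_gldim (polynomial_ring R n) = (G_gldim R + n%:Z%:E)%E.
Proof.
rewrite /polynomial_ring; case: pselect => [h|/negP/negPn/eqP R0]; last first.
  (* Over the zero ring every module is zero, and both sides are -oo. *)
  by rewrite G_gldim_trivial.
(* Only the packaging differs: once [R] is destructed, the two ring structures are convertible. *)
have -> : G_gldim R = G_gldim (nontrivial h : comNzRingType).
  by congr G_gldim; case: R h => T [].
pose A : comNzRingType := nontrivial h; rewrite -/A.
have mp := mpoly_hull A n.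
have [[k [hk mk ->]]|[nk ->]] := G_gldim_cases (oner_neq0 A);
  have [[l [hl ml ->]]|[nl ->]] := G_gldim_cases (oner_neq0 (mpoly n A)) => //.
- rewrite -EFinD -PoszD; congr (_%:Z%:E).
  have [nl hln] := (mp l).1 hl.
  apply/eqP; rewrite eqn_leq; apply/andP; split.
    by apply: ml; apply/mp; rewrite leq_addl addnK.
  by rewrite -(subnK nl) leq_add2r mk.
- by case: (nl (k + n)%N); apply/mp; rewrite leq_addl addnK.
- by case: (nk (l - n)%N); case: ((mp l).1 hl).
Qed.
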